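(* Let $\varepsilon > 0$ be fixed, and let $p = p(n) \in [0,1]$ satisfy $p \geq n^{-4/11+\varepsilon}$. Let $G \sim G(n,p)$. Then with high probability $G$ admits a fractional triangle decomposition; that is, the probability that $G$ admits a fractional triangle decomposition tends to $1$ as $n \to \infty$.
   Context: $G(n,p)$ is the binomial (Erdős–Rényi) random graph on $n$ vertices, in which each of the $\binom n2$ potential edges is present independently with probability $p$. A sequence of events parameterized by $n$ occurs with high probability if their probabilities tend to $1$ as $n\to\infty$. A fractional triangle decomposition of a graph $G$ is a function $\varphi$ assigning to each triangle $T$ of $G$ a real weight $\varphi(T) \ge 0$ such that for every edge $e$ of $G$, the sum of $\varphi(T)$ over all triangles $T$ of $G$ containing $e$ equals $1$. *)

(* Defs.v *)
From HB Require Import structures.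
From mathcomp Require Import all_boot all_order all_algebra.
From mathcomp Require Import all_classical all_reals all_analysis.
Set Implicit Arguments.
Unset Strict Implicit.
Unset Printing Implicit Defensive.
Import Order.TTheory GRing.Theory Num.Theory.
Import numFieldNormedType.Exports.
Local Open Scope ring_scope.

(* A simple graph on the vertex set 'I_n is given by its edge set, a subset of
   [potential_edges n]. *)
Definition potential_edges (n : nat) : {set {set 'I_n}} :=
  [set e : {set 'I_n} | #|e| == 2].

Definition triangles (n : nat) (E : {set {set 'I_n}}) : {set {set 'I_n}} :=
  [set T : {set 'I_n} | (#|T| == 3) &&
    [forall x in T, forall y in T, (x != y) ==> ([set x; y]%SET \in E)]].

(* Only the values of [phi] on [triangles E] matter; the weight of a triangle
   is read off its vertex set. *)
Definition fractional_triangle_decomposition (R : realType) (n : nat)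
    (E : {set {set 'I_n}}) (phi : {set 'I_n} -> R) : Prop :=
  (forall T, T \in triangles E -> 0 <= phi T) /\
  (forall e, e \in E -> \sum_(T in triangles E | e \subset T) phi T = 1).

Definition has_fractional_triangle_decomposition (R : realType) (n : nat)
    (E : {set {set 'I_n}}) : Prop :=
  exists phi : {set 'I_n} -> R, fractional_triangle_decomposition E phi.

Definition gnp_mass (R : realType) (n : nat) (p : R)
    (E : {set {set 'I_n}}) : R :=
  \prod_(e in potential_edges n) (if e \in E then p else 1 - p).

Definition gnp_prob (R : realType) (n : nat) (p : R)
    (A : {set {set 'I_n}} -> Prop) : R :=
  \sum_(E in powerset (potential_edges n) | `[< A E >]) gnp_mass p E.

(* Each fixed set S of potential edges is present with probability p ^ #|S|:
   the edges are independent, and (S = set0) the total mass is 1. *)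
Lemma gnp_prob_subset (R : realType) (n : nat) (p : R)
    (S : {set {set 'I_n}}) :
  S \subset potential_edges n ->
  gnp_prob p (fun E => is_true (S \subset E)) = p ^+ #|S|.
Proof.
move=> /fintype.subsetP SK; rewrite /gnp_prob /gnp_mass; set K := potential_edges n in SK *.
pose F (e : {set 'I_n}) : R := if e \in K then p else 0.
pose G (e : {set 'I_n}) : R :=
  if e \in K then (if e \in S then 0 else 1 - p) else 1.
have -> : p ^+ #|S| = \prod_e (F e + G e).
  rewrite (bigID (mem S)) /= [X in _ * X]big1 ?mulr1; last first.
    move=> e /negbTE eS; rewrite /F /G eS; case: ifP => _; last by rewrite add0r.
    by rewrite addrC subrK.
  rewrite (eq_bigr (fun=> p)) ?prodr_const // => e eS.
  by rewrite /F /G (SK _ eS) eS addr0.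
rewrite bigA_distr [RHS](bigID (fun J : {set {set 'I_n}} =>
  (J \in powerset K) && `[< is_true (S \subset J) >])) /=.
rewrite [X in _ = _ + X]big1 ?addr0.
  apply: eq_bigr => J /andP[]; rewrite inE => /fintype.subsetP JK /asboolP /fintype.subsetP SJ.
  rewrite [RHS](bigID (mem K)) /= [X in _ = _ * X]big1 ?mulr1.
    apply: eq_bigr => e eK; rewrite /F /G eK; case: ifPn => // eJ.
    by case: ifPn => // /SJ; rewrite (negbTE eJ).
  move=> e eK; rewrite /F /G (negbTE eK); case: ifPn => // /JK.
  by rewrite (negbTE eK).
move=> J; rewrite negb_and inE => /orP[/fintype.subsetPn[e eJ eK]|].
  by rewrite (bigD1 e) //= eJ /F (negbTE eK) mul0r.
rewrite asboolb => /fintype.subsetPn[e eS eJ].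
by rewrite (bigD1 e) //= (negbTE eJ) /G (SK _ eS) eS mul0r.
Qed.

(* Main.v *)
From HB Require Import structures.
Require Import Defs.
From mathcomp Require Import all_boot all_order all_algebra.
From mathcomp Require Import all_classical all_reals all_analysis.
From mathcomp Require Import ring lra.
Import Order.TTheory GRing.Theory Num.Theory.
Import numFieldNormedType.Exports.
Local Open Scope ring_scope.

(** Write d = n p^2 and D = n p, and look for weights of the form
    phi(T) = (1/d) * (sum of Y(e) over the edges e of T). The condition is L Y = 1, where
    L f(uv) = (codeg(uv) f(uv) + sum of f(uw) + f(vw) over common neighbours w of u, v) / d.
    On a typical graph L is close, in L2 operator norm, to the identity plus a "star" operator
    f |-> (R(u) + R(v)) / D, with R(u) the sum of f over the edges at u. The latter has an
    explicit inverse P, so that err = 1 - L P has L2 norm n^(-c). In sup norm err is only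
    bounded by a constant (25), but this suffices: the right-hand side 1 - L(1/3) has sup norm
    n^(-c'), so a bounded number K of terms of the Neumann series remain small in sup norm, and
    the rest of the series is bounded through its L2 norm, once n^(-cK) beats the number n^2
    of entries. Hence Y = 1/3 + o(1) is positive.

    The L2 bound needs that, inside each neighbourhood N(u), the adjacency operator A is small
    on functions of mean zero. This is read off A^3, whose entries count the paths of length
    three inside N(u); they are concentrated around n^2 p^5, a positive power of n.
    Degrees, codegrees and these path counts are controlled by one exponential-moment bound
    for bilinear forms whose coefficients depend on previously exposed edges. *)

(** * Cauchy-Schwarz, the Schur test, and norms of matrix cubes *)

Section SumInequalities.
Variables (R : realFieldType) (T : finType).
Implicit Types (w f g z : T -> R) (M : T -> T -> R).

(** Lagrange's identity: right side minus left side is half the double sum of w_i w_j (f_i g_j - f_j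
    g_i)^2. *)
Lemma weighted_cauchy_schwarz w f g : (forall i, 0 <= w i) ->
  (\sum_i w i * (f i * g i)) ^+ 2 <=
  (\sum_i w i * f i ^+ 2) * (\sum_i w i * g i ^+ 2).
Proof.
move=> w0.
have : 0 <= \sum_i \sum_j w i * w j * (f i * g j - f j * g i) ^+ 2.
  by do 2!(apply: sumr_ge0 => ? _); rewrite mulr_ge0 ?sqr_ge0// mulr_ge0.
have -> : \sum_i \sum_j w i * w j * (f i * g j - f j * g i) ^+ 2 =
    2 * ((\sum_i w i * f i ^+ 2) * (\sum_i w i * g i ^+ 2)) -
    2 * (\sum_i w i * (f i * g i)) ^+ 2.
  transitivity (\sum_i \sum_j (w i * f i ^+ 2 * (w j * g j ^+ 2) +
      w i * g i ^+ 2 * (w j * f j ^+ 2) -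
      2 * (w i * (f i * g i) * (w j * (f j * g j))))).
    by apply: eq_bigr => i _; apply: eq_bigr => j _; ring.
  under eq_bigr => i _ do rewrite sumrB big_split /= -!mulr_sumr.
  by rewrite sumrB big_split /= -!mulr_sumr -!mulr_suml; ring.
by lra.
Qed.

Lemma weighted_sum_sqr w f : (forall i, 0 <= w i) ->
  (\sum_i w i * f i) ^+ 2 <= (\sum_i w i) * (\sum_i w i * f i ^+ 2).
Proof.
move=> w0; have := weighted_cauchy_schwarz w (fun=> 1) f w0.
by under eq_bigr do rewrite mul1r; under [in leRHS]eq_bigr do rewrite expr1n mulr1.
Qed.

Lemma cauchy_schwarz f g :
  (\sum_i f i * g i) ^+ 2 <= (\sum_i f i ^+ 2) * (\sum_i g i ^+ 2).
Proof.
have := weighted_cauchy_schwarz (fun=> 1) f g (fun=> ler01).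
congr (is_true (_ ^+ 2 <= _ * _)); by apply: eq_bigr => i _; rewrite mul1r.
Qed.

Lemma sum_sqr f : (\sum_i f i) ^+ 2 <= #|T|%:R * \sum_i f i ^+ 2.
Proof.
have := weighted_sum_sqr (fun=> 1) f (fun=> ler01); rewrite sumr_const.
congr (is_true (_ ^+ 2 <= _ * _)); by apply: eq_bigr => i _; rewrite mul1r.
Qed.

Section Schur.
Variables (M : T -> T -> R) (rho : R).
Hypothesis Msym : forall i j, M i j = M j i.
Hypothesis Mrow : forall i, \sum_j `|M i j| <= rho.

(** Bound z_i z_j by (z_i^2 + z_j^2) / 2 in absolute value; by symmetry both halves are then
    controlled by row sums. *)
Lemma schur_test_form z :
  \sum_i \sum_j M i j * (z i * z j) <= rho * \sum_i z i ^+ 2.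
Proof.
have Mij i j : M i j * (z i * z j) <= `|M i j| * z i ^+ 2 / 2 + `|M j i| * z j ^+ 2 / 2.
  rewrite (Msym j i).
  have h1 : M i j * (z i * z j) <= `|M i j| * `|z i * z j|.
    by rewrite -normrM ler_norm.
  have h2 : `|z i * z j| <= (z i ^+ 2 + z j ^+ 2) / 2.
    have := sqr_ge0 (z i + z j); have := sqr_ge0 (z i - z j).
    by rewrite ler_norml sqrrB sqrrD => ? ?; apply/andP; split; lra.
  apply: (le_trans h1); apply: le_trans (ler_wpM2l (normr_ge0 _) h2) _.
  by rewrite le_eqVlt; apply/orP; left; apply/eqP; field.
apply: le_trans (_ : \sum_i \sum_j (`|M i j| * z i ^+ 2 / 2 + `|M j i| * z j ^+ 2 / 2) <= _).
  by do 2!(apply: ler_sum => ? _).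
under eq_bigr do rewrite big_split /=.
rewrite big_split /= [X in _ + X]exchange_big /= -big_split /= mulr_sumr.
apply: ler_sum => i _; rewrite -mulr_suml -mulr_suml.
by rewrite (_ : _ + _ = (\sum_j `|M i j|) * z i ^+ 2); [rewrite ler_wpM2r ?sqr_ge0|field].
Qed.

(** Cauchy-Schwarz in each row with weights |M i j| costs one factor [rho]. After exchanging the
    sums, the column sums, equal to row sums by symmetry, cost the other. *)
Lemma schur_test z :
  \sum_i (\sum_j M i j * z j) ^+ 2 <= rho ^+ 2 * \sum_i z i ^+ 2.
Proof.
have [i0|none] := pickP (@predT T); last first.
  by rewrite !big_pred0 ?mulr0// => i; move: (none i).
move=> _; have rho0 : 0 <= rho.
  by apply: le_trans (Mrow i0); apply: sumr_ge0 => j _.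
apply: le_trans (_ : \sum_i rho * \sum_j `|M i j| * z j ^+ 2 <= _).
  apply: ler_sum => i _.
  apply: le_trans (_ : (\sum_j `|M i j| * `|z j|) ^+ 2 <= _).
    rewrite -[leLHS]real_normK ?num_real//; apply: lerXn2r.
    - by rewrite nnegrE.
    - by rewrite nnegrE; apply: sumr_ge0 => j _; rewrite mulr_ge0.
    - apply: le_trans (ler_norm_sum _ _ _) _.
      by apply: ler_sum => j _; rewrite normrM.
  apply: le_trans (weighted_sum_sqr _ _ (fun=> normr_ge0 _)) _.
  apply: le_trans (ler_wpM2r _ (Mrow i)) _.
    by apply: sumr_ge0 => j _; rewrite mulr_ge0 ?sqr_ge0.
  rewrite ler_wpM2l// ler_sum// => j _; rewrite real_normK ?num_real//.
rewrite -mulr_sumr exchange_big /= expr2 -mulrA ler_wpM2l// mulr_sumr.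
apply: ler_sum => j _; rewrite -mulr_suml ler_wpM2r ?sqr_ge0//.
by under eq_bigr do rewrite Msym.
Qed.

End Schur.

Section CubeNorm.
Variables (b : T -> T -> R) (b_sym : forall i j, b i j = b j i).
Let app z i := \sum_j b i j * z j.

Lemma symmetric_dot f g : \sum_i f i * app g i = \sum_i app f i * g i.
Proof.
rewrite /app; under eq_bigr do rewrite mulr_sumr.
rewrite exchange_big; apply: eq_bigr => i _; rewrite mulr_suml.
by apply: eq_bigr => j _; rewrite b_sym; ring.
Qed.

(* With b symmetric, |bz|^2 <= |z| |b^2 z| and |b^2 z|^2 <= |bz| |b^3 z|. *)
Lemma norm_of_cube z t : 0 <= t ->
  \sum_i app (app (app z)) i ^+ 2 <= (t ^+ 3) ^+ 2 * \sum_i z i ^+ 2 ->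
  \sum_i app z i ^+ 2 <= t ^+ 2 * \sum_i z i ^+ 2.
Proof.
move=> t0; set al := \sum_i z i ^+ 2; set be := \sum_i app z i ^+ 2.
set om := \sum_i app (app (app z)) i ^+ 2 => om_le.
pose ga := \sum_i app (app z) i ^+ 2.
have sq0 f : 0 <= \sum_i f i ^+ 2 by apply: sumr_ge0 => i _; rewrite sqr_ge0.
have [al0 be0 ga0 om0] : [/\ 0 <= al, 0 <= be, 0 <= ga & 0 <= om] by rewrite !sq0.
have h1 : be ^+ 2 <= al * ga.
  have -> : be = \sum_i z i * app (app z) i.
    by rewrite symmetric_dot; apply: eq_bigr => i _; rewrite expr2.
  exact: cauchy_schwarz.
have h2 : ga ^+ 2 <= be * om.
  have -> : ga = \sum_i app z i * app (app (app z)) i.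
    by rewrite symmetric_dot; apply: eq_bigr => i _; rewrite expr2.
  exact: cauchy_schwarz.
have [be_eq0|be_neq0] := eqVneq be 0.
  by rewrite be_eq0 mulr_ge0 ?exprn_ge0.
have be_gt0 : 0 < be by rewrite lt_def be_neq0.
have h3 : be ^+ 3 <= al ^+ 2 * om.
  rewrite -(ler_pM2l be_gt0) -exprS.
  apply: le_trans (_ : (al * ga) ^+ 2 <= _).
    by rewrite (_ : 4 = 2 * 2)%N // exprM lerXn2r ?nnegrE ?mulr_ge0 ?exprn_ge0.
  rewrite exprMn [be * _]mulrCA ler_wpM2l ?exprn_ge0//.
have h4 : be ^+ 3 <= (t ^+ 2 * al) ^+ 3.
  apply: (le_trans h3); rewrite exprMn -exprM.
  apply: le_trans (ler_wpM2l (exprn_ge0 2 al0) om_le) _.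
  rewrite -exprM; lra.
by move: h4; rewrite ler_pXn2r ?nnegrE ?mulr_ge0 ?exprn_ge0//.
Qed.

End CubeNorm.
End SumInequalities.

(** * Deterministic part: a graph with regular degrees, codegrees and path counts *)

Section Pseudorandom.
Variables (R : realFieldType) (n : nat) (a : 'I_n -> 'I_n -> R) (p dl : R).
Hypothesis a_idem : forall u v, a u v * a u v = a u v.
Hypothesis a_sym : forall u v, a u v = a v u.
Hypothesis a_irr : forall u, a u u = 0.

Let D : R := n%:R * p.
Let d : R := n%:R * p ^+ 2.
(** Expected number of paths w x y w' inside N(u), given w and w' in N(u): about n^2 choices of x
    and y, and the five edges ux, wx, uy, w'y, xy. *)
Let theta : R := n%:R ^+ 2 * p ^+ 5.
Let deg u := \sum_w a u w.
Let codeg u v := \sum_w a u w * a v w.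

Hypothesis p_gt0 : 0 < p.
Hypothesis p_le1 : p <= 1.
Hypothesis n_gt0 : 0 < n%:R :> R.
Hypothesis dl_ge0 : 0 <= dl.
Hypothesis dl_le : dl <= 1 / 2.
Hypothesis deg_approx : forall u, `|deg u - D| <= dl * D.
Hypothesis codeg_approx : forall u v, u != v -> `|codeg u v - d| <= dl * d.
Hypothesis path_approx : forall u w w', a u w = 1 -> a u w' = 1 ->
  `|\sum_(x | x != w') \sum_(y | y != w)
      a u x * a w x * (a u y * a w' y) * a x y - theta| <= dl * theta.

Lemma adj_ge0 u v : 0 <= a u v.
Proof. by rewrite -a_idem -expr2 sqr_ge0. Qed.

Lemma adj01 u v : (a u v == 0) || (a u v == 1).
Proof.
by rewrite -[X in _ || X]subr_eq0 -mulf_eq0 mulrBr mulr1 a_idem subrr.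
Qed.

Lemma adj_le1 u v : a u v <= 1.
Proof. by case/orP: (adj01 u v) => /eqP->. Qed.

Let D_gt0 : 0 < D. Proof. exact: mulr_gt0. Qed.
Let d_gt0 : 0 < d. Proof. by rewrite mulr_gt0// exprn_gt0. Qed.

Let D_ge0 : 0 <= D. Proof. exact: ltW. Qed.
Let d_ge0 : 0 <= d. Proof. exact: ltW. Qed.
Let theta_ge0 : 0 <= theta.
Proof. by rewrite mulr_ge0// exprn_ge0// ltW. Qed.

Lemma deg_le u : deg u <= 2 * D.
Proof.
have := deg_approx u; rewrite ler_norml => /andP[_ h].
have : dl * D <= 1 / 2 * D by rewrite ler_pM2r.
by have := D_gt0; lra.
Qed.

Lemma deg_ge u : D / 2 <= deg u.
Proof.
have := deg_approx u; rewrite ler_norml => /andP[h _].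
have : dl * D <= 1 / 2 * D by rewrite ler_pM2r.
by have := D_gt0; lra.
Qed.

Lemma deg_ge0 u : 0 <= deg u.
Proof. by rewrite sumr_ge0// => i _; exact: adj_ge0. Qed.

Lemma codeg_ge0 u v : 0 <= codeg u v.
Proof. by rewrite sumr_ge0// => i _; rewrite mulr_ge0 ?adj_ge0. Qed.

Lemma codeg_le u v : u != v -> codeg u v <= 2 * d.
Proof.
move=> /codeg_approx; rewrite ler_norml => /andP[_ h].
have : dl * d <= 1 / 2 * d by rewrite ler_pM2r.
by have := d_gt0; lra.
Qed.

(** Expanding the square gives the quadratic form of (A - pJ)^2, with J the all-ones matrix. Its
    entries involve only degrees and codegrees: at most 3 D on the diagonal and 3 dl d off it. As n
    d = D^2, the Schur test gives the bound. *)
Lemma global_mixing h :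
  \sum_u (\sum_v a u v * h v - p * \sum_v h v) ^+ 2 <=
  (3 * dl + 3 / D) * D ^+ 2 * \sum_u h u ^+ 2.
Proof.
pose M v w := \sum_u (a u v - p) * (a u w - p).
have -> : \sum_u (\sum_v a u v * h v - p * \sum_v h v) ^+ 2 =
    \sum_v \sum_w M v w * (h v * h w).
  transitivity (\sum_u \sum_v \sum_w (a u v - p) * (a u w - p) * (h v * h w)).
    apply: eq_bigr => u _; rewrite mulr_sumr -sumrB expr2 mulr_suml.
    apply: eq_bigr => v _; rewrite mulr_sumr; apply: eq_bigr => w _; ring.
  rewrite exchange_big; apply: eq_bigr => v _.
  rewrite exchange_big; apply: eq_bigr => w _.
  by rewrite mulr_suml.
have ME v w : M v w = codeg v w - p * deg v - p * deg w + d.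
  transitivity (\sum_u (a v u * a w u - p * a v u - p * a w u + p ^+ 2)).
    by apply: eq_bigr => u _; rewrite (a_sym v) (a_sym w); ring.
  rewrite big_split /= !sumrB -!mulr_sumr sumr_const card_ord -mulr_natl.
  by congr (_ + _); rewrite /d; ring.
have Msym v w : M v w = M w v by apply: eq_bigr => u _; rewrite mulrC.
have DE : D ^+ 2 = n%:R * d by rewrite /D /d; ring.
have pD : p * D = d by rewrite /D /d; ring.
have dD : d <= D by rewrite -pD ler_piMl// ltW.
apply: schur_test_form Msym _ _ => v.
rewrite (bigD1 v)//=.
have diag : `|M v v| <= 3 * D.
  have -> : M v v = deg v * (1 - 2 * p) + d.
    rewrite ME /codeg; under eq_bigr do rewrite a_idem.
    by rewrite -/(deg v); ring.
  apply: le_trans (ler_normD _ _) _; rewrite normrM (ger0_norm (deg_ge0 v)).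
  rewrite (gtr0_norm d_gt0).
  have : deg v * `|1 - 2 * p| <= deg v * 1.
    rewrite ler_wpM2l ?deg_ge0// ler_norml; apply/andP; split; have := p_gt0; have := p_le1; lra.
  have := deg_le v; lra.
have off w : w != v -> `|M v w| <= 3 * (dl * d).
  rewrite eq_sym => /codeg_approx.
  have := deg_approx v; have := deg_approx w.
  rewrite ME !ler_norml => /andP[h1 h2] /andP[h3 h4] /andP[h5 h6].
  have bound x : x <= dl * D -> p * x <= dl * d.
    by move=> xle; rewrite -pD mulrCA ler_wpM2l// ltW.
  have h1' : - (deg w - D) <= dl * D by lra.
  have h3' : - (deg v - D) <= dl * D by lra.
  have {h1'}:= bound _ h1'; have {h3'}:= bound _ h3'.
  have {h2} := bound _ h2; have {h4} := bound _ h4.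
  rewrite !mulrN !mulrBr !pD => ? ? ? ?.
  by apply/andP; split; lra.
apply: le_trans (lerD diag (ler_sum _ off)) _.
rewrite sumr_const -[X in _ + X <= _]mulr_natl.
have : #|[pred w | w != v]|%:R * (3 * (dl * d)) <= n%:R * (3 * (dl * d)).
  apply: ler_wpM2r; first by rewrite !mulr_ge0// ltW.
  by rewrite ler_nat -[leqRHS]card_ord max_card.
have -> : (3 * dl + 3 / D) * D ^+ 2 = n%:R * (3 * (dl * d)) + 3 * D.
  by rewrite mulrDl {1}DE; field; rewrite gt_eqF.
by move=> ?; rewrite addrC lerD2r.
Qed.

Let theta_d : theta * D = d ^+ 3.
Proof. by rewrite /theta /D /d; ring. Qed.

(** * Spectral gap of the graph induced on a neighbourhood *)

Section Neighborhood.
Variables (u : 'I_n) (z : 'I_n -> R) (eta : R).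
Hypothesis z_supp : forall w, a u w * z w = z w.
Hypothesis eta_ge0 : 0 <= eta.
Hypothesis eta_ge : 2 * dl + 8 / d <= eta ^+ 3.

(** The adjacency matrix of the graph induced on N(u); [paths] gives the entries of its cube at
    pairs in N(u). *)
Let b w w' := a u w * a u w' * a w w'.
Let app (x : 'I_n -> R) w := \sum_w' b w w' * x w'.
Let paths w w' := \sum_x \sum_y a u x * a w x * (a u y * a w' y) * a x y.

Let b_sym w w' : b w w' = b w' w.
Proof. by rewrite /b (a_sym w') [a u w * _]mulrC. Qed.

Lemma adj_neq w w' : a w w' = 1 -> w != w'.
Proof.
by move=> aww; apply/eqP => ww'; move: aww; rewrite ww' a_irr => /esym/eqP; rewrite oner_eq0.
Qed.

(* The degenerate walks are those with x = w' or y = w. *)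
Lemma paths_approx w w' : a u w = 1 -> a u w' = 1 ->
  `|paths w w' - theta| <= dl * theta + 4 * d * a w w'.
Proof.
move=> uw uw'; pose G x y := a u x * a w x * (a u y * a w' y) * a x y.
have G0 x y : 0 <= G x y by rewrite !mulr_ge0 ?adj_ge0.
have split_paths : paths w w' = \sum_(x | x != w') \sum_(y | y != w) G x y +
    (\sum_(x | x != w') G x w + \sum_y G w' y).
  rewrite /paths (bigD1 w')//= addrC addrA; congr (_ + _).
  rewrite addrC -big_split /=; apply: eq_bigr => x _.
  by rewrite (bigD1 w)//= addrC.
have le1 : \sum_(x | x != w') G x w <= 2 * d * a w w'.
  apply: le_trans (_ : \sum_x a u x * a w x * a w w' <= _).
    rewrite [leRHS](bigD1 w')//= ler_wpDl ?mulr_ge0 ?adj_ge0//.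
    apply: ler_sum => x _; rewrite /G uw mul1r (a_sym w' w).
    by rewrite ler_piMr ?mulr_ge0 ?adj_ge0 ?adj_le1.
  rewrite -mulr_suml ler_wpM2r ?adj_ge0// codeg_le//.
  exact: adj_neq.
have le2 : \sum_y G w' y <= 2 * d * a w w'.
  apply: le_trans (_ : \sum_y a u y * a w' y * a w w' <= _).
    apply: ler_sum => y _; rewrite /G uw' mul1r [leRHS]mulrC.
    by rewrite ler_piMr ?mulr_ge0 ?adj_ge0 ?adj_le1.
  rewrite -mulr_suml ler_wpM2r ?adj_ge0// codeg_le//.
  exact: adj_neq.
have ge1 : 0 <= \sum_(x | x != w') G x w by rewrite sumr_ge0.
have ge2 : 0 <= \sum_y G w' y by rewrite sumr_ge0.
have := path_approx _ _ _ uw uw'; rewrite -/(G _ _) split_paths !ler_norml.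
move=> /andP[h1 h2]; apply/andP; split; lra.
Qed.

Lemma app_cube w :
  app (app (app z)) w = \sum_w' a u w * a u w' * paths w w' * z w'.
Proof.
rewrite /app; transitivity (\sum_x \sum_y \sum_w' b w x * b x y * b y w' * z w').
  apply: eq_bigr => x _; rewrite mulr_sumr; apply: eq_bigr => y _.
  by rewrite !mulr_sumr; apply: eq_bigr => w' _; ring.
under eq_bigr do rewrite exchange_big.
rewrite exchange_big; apply: eq_bigr => w' _.
rewrite /paths mulr_sumr mulr_suml; apply: eq_bigr => x _.
rewrite mulr_sumr mulr_suml; apply: eq_bigr => y _.
rewrite /b (a_sym w' y); transitivity ((a u x * a u x) * (a u y * a u y) *
  (a u w * a u w' * a w x * a x y * a y w') * z w'); first by ring.
by rewrite !a_idem; ring.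
Qed.

(** Since z has sum zero, theta can be subtracted from every entry of the cube of [b] on N(u)
    without changing its value at z. By [paths_approx] the remaining rows have absolute sum at most
    2 dl theta D + 8 d^2 = (2 dl + 8 / d) d^3 <= (eta d)^3. The Schur test bounds the cube, and
    [norm_of_cube] takes the root. *)
Lemma gap_on_neighborhood : \sum_w z w = 0 ->
  \sum_w (app z w) ^+ 2 <= (eta * d) ^+ 2 * \sum_w z w ^+ 2.
Proof.
move=> sumz; apply: norm_of_cube => //; first exact: mulr_ge0.
pose M w w' := a u w * a u w' * (paths w w' - theta).
have paths_sym w w' : paths w w' = paths w' w.
  rewrite /paths exchange_big; apply: eq_bigr => x _; apply: eq_bigr => y _.
  by rewrite (a_sym y x); ring.
have Msym w w' : M w w' = M w' w by rewrite /M paths_sym [a u w * _]mulrC.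
have -> : \sum_w app (app (app z)) w ^+ 2 = \sum_w (\sum_w' M w w' * z w') ^+ 2.
  apply: eq_bigr => w _; congr (_ ^+ 2); rewrite app_cube.
  have z0 : \sum_w' a u w * theta * z w' = 0 by rewrite -mulr_sumr sumz mulr0.
  apply/eqP; rewrite -subr_eq0 -sumrB -[X in _ == X]z0; apply/eqP.
  by apply: eq_bigr => w' _; rewrite /M -{3}(z_supp w'); ring.
apply: schur_test => // w.
have [uw|uw] := orP (adj01 u w); last first.
  apply: le_trans (_ : \sum_w' (a u w' * (dl * theta) + 4 * d * (a u w' * a w w')) <= _).
    apply: ler_sum => w' _; rewrite /M (eqP uw) mul1r normrM (ger0_norm (adj_ge0 _ _)).
    have [/eqP->|/eqP uw'] := orP (adj01 u w'); first by rewrite !mul0r mulr0 addr0.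
    by rewrite uw' !mul1r paths_approx// (eqP uw).
  rewrite big_split /= -mulr_suml -mulr_sumr.
  have h1 : deg u * (dl * theta) <= 2 * D * (dl * theta).
    by apply: ler_wpM2r (deg_le u); exact: mulr_ge0.
  have h2 : 4 * d * codeg u w <= 4 * d * (2 * d).
    by apply: ler_wpM2l; [exact: mulr_ge0|exact/codeg_le/adj_neq/eqP].
  apply: le_trans (lerD h1 h2) _.
  rewrite exprMn; apply: le_trans (_ : (2 * dl + 8 / d) * d ^+ 3 <= _).
    have -> : (2 * dl + 8 / d) * d ^+ 3 = 2 * dl * (theta * D) + 8 * d ^+ 2.
      by rewrite theta_d; field; rewrite gt_eqF.
    lra.
  by apply: ler_wpM2r => //; rewrite exprn_ge0.
rewrite big1; first by rewrite exprn_ge0// mulr_ge0.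
by move=> w' _; rewrite /M (eqP uw) !mul0r normr0.
Qed.

End Neighborhood.

(** * The preconditioned operator and its error in L2 norm *)

Variable eta : R.
Hypothesis eta_ge0 : 0 <= eta.
Hypothesis eta_ge : 2 * dl + 8 / d <= eta ^+ 3.

Let deg_ratio u : `|deg u / D - 1| <= dl.
Proof.
rewrite -(ler_pM2r D_gt0) -{2}(gtr0_norm D_gt0) -normrM mulrBl mul1r.
by rewrite divfK ?gt_eqF// deg_approx.
Qed.

Let codeg_ratio u v : u != v -> `|codeg u v / d - 1| <= dl.
Proof.
move=> uv; rewrite -(ler_pM2r d_gt0) -{2}(gtr0_norm d_gt0) -normrM mulrBl mul1r.
by rewrite divfK ?gt_eqF// codeg_approx.
Qed.

Let sqr_bound (x y : R) : `|x| <= y -> x ^+ 2 <= y ^+ 2.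
Proof.
move=> xy; rewrite -real_normK ?num_real//; apply: lerXn2r; rewrite ?nnegrE//.
exact: le_trans xy.
Qed.

(** This replaces triangle sums by star sums. On N(u) write y as its mean m plus a part z of mean
    zero: m contributes m (codeg / d - deg / D), a relative error of at most 2 dl, and z is handled
    by the spectral gap. *)
Lemma neighborhood_mixing u y :
  \sum_v a u v * ((\sum_w a u w * a v w * y w) / d - (\sum_w a u w * y w) / D) ^+ 2
  <= (8 * dl ^+ 2 + 2 * eta ^+ 2) * \sum_w a u w * y w ^+ 2.
Proof.
have deg_gt0 : 0 < deg u by apply: lt_le_trans (deg_ge u); rewrite divr_gt0.
pose S := \sum_w a u w * y w; pose Q := \sum_w a u w * y w ^+ 2.
pose m := S / deg u; pose z w := a u w * (y w - m).
have Sm : S = deg u * m by rewrite /m mulrC divfK ?gt_eqF.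
have z_supp w : a u w * z w = z w by rewrite /z mulrA a_idem.
have sumz : \sum_w z w = 0.
  rewrite /z; under eq_bigr do rewrite mulrBr.
  by rewrite sumrB -mulr_suml -/S -/(deg u) Sm subrr.
have mQ : deg u * m ^+ 2 <= Q.
  rewrite -(ler_pM2l deg_gt0); have := weighted_sum_sqr _ _ (a u) y (adj_ge0 u).
  by rewrite -/S -/Q -/(deg u) Sm exprMn [deg u ^+ 2]expr2 -mulrA.
have zQ : \sum_w z w ^+ 2 <= Q.
  have -> : \sum_w z w ^+ 2 = Q - deg u * m ^+ 2.
    transitivity (\sum_w (a u w * y w ^+ 2 - 2 * m * (a u w * y w) + m ^+ 2 * a u w)).
      by apply: eq_bigr => w _; rewrite /z exprMn expr2 a_idem; ring.
    by rewrite big_split /= sumrB -!mulr_sumr -/Q -/S -/(deg u) Sm; ring.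
  by rewrite lerBlDr lerDl mulr_ge0 ?sqr_ge0 ?ltW.
pose g v := \sum_w' a u v * a u w' * a v w' * z w'.
have gap := gap_on_neighborhood _ _ _ z_supp eta_ge0 eta_ge sumz; rewrite -/(g _) in gap.
have term v : a u v * ((\sum_w a u w * a v w * y w) / d - S / D) ^+ 2 <=
    a u v * (8 * dl ^+ 2 * m ^+ 2) + 2 / d ^+ 2 * g v ^+ 2.
  have [/eqP->|/eqP uv] := orP (adj01 u v).
    by rewrite !mul0r add0r mulr_ge0 ?sqr_ge0// divr_ge0 ?sqr_ge0.
  have gE : g v = \sum_w a u w * a v w * y w - codeg u v * m.
    rewrite /g /codeg mulr_suml -sumrB; apply: eq_bigr => w _.
    rewrite uv /z; transitivity (a u w * a u w * (a v w * (y w - m))); first by ring.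
    by rewrite a_idem; ring.
  rewrite uv !mul1r (_ : _ / d - _ = m * (codeg u v / d - deg u / D) + g v / d); last first.
    by rewrite gE Sm; ring.
  apply: le_trans (_ : 2 * (m * (codeg u v / d - deg u / D)) ^+ 2 + 2 * (g v / d) ^+ 2 <= _).
    have := sqr_ge0 (m * (codeg u v / d - deg u / D) - g v / d).
    by rewrite sqrrB sqrrD; lra.
  have -> : 2 * (g v / d) ^+ 2 = 2 / d ^+ 2 * g v ^+ 2 by field; rewrite gt_eqF.
  rewrite lerD2r exprMn.
  have : (codeg u v / d - deg u / D) ^+ 2 <= (2 * dl) ^+ 2.
    apply: sqr_bound; rewrite (_ : _ - _ = (codeg u v / d - 1) - (deg u / D - 1)); last by ring.
    apply: le_trans (ler_normB _ _) _; rewrite mulr2n mulrDl mul1r.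
    exact: lerD (codeg_ratio _ _ (adj_neq _ _ uv)) (deg_ratio u).
  by move=> /(ler_wpM2l (sqr_ge0 m)); lra.
apply: le_trans (ler_sum _ (fun v _ => term v)) _.
rewrite big_split /= -mulr_suml -mulr_sumr -/(deg u) -/Q.
have h1 : deg u * (8 * dl ^+ 2 * m ^+ 2) <= 8 * dl ^+ 2 * Q.
  by rewrite mulrCA ler_wpM2l// mulr_ge0 ?sqr_ge0.
have h2 : 2 / d ^+ 2 * \sum_v g v ^+ 2 <= 2 * eta ^+ 2 * Q.
  apply: le_trans (ler_wpM2l _ gap) _; first by rewrite divr_ge0 ?sqr_ge0.
  rewrite [leLHS](_ : _ = 2 * eta ^+ 2 * \sum_w z w ^+ 2).
    by apply: ler_wpM2l => //; rewrite mulr_ge0 ?sqr_ge0.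
  by field; rewrite gt_eqF.
by rewrite [leRHS]mulrDl; apply: lerD.
Qed.

Implicit Type f : 'I_n -> 'I_n -> R.

Let sqnorm f := \sum_u \sum_v a u v * f u v ^+ 2.
Let rsum f u := \sum_w a u w * f u w.
Let kap f := (\sum_u rsum f u) / (3 * n%:R * D).
(* The main part of L multiplies the functions g u + g v with g of mean zero by 2 and constants
   by 3; this is where the 2 * D here and the 3 in kap come from. *)
Let prec f u v := a u v * (f u v - (rsum f u + rsum f v) / (2 * D) + kap f).
(** Edge functions are functions of ordered pairs, not assumed symmetric: [tri f u v] and
    [tri f v u] collect the edges at u and those at v. *)
Let tri f u v := \sum_w a u w * a v w * f u w.
Let lap f u v := a u v * (codeg u v * f u v + tri f u v + tri f v u) / d.
Let err f u v := a u v * f u v - lap (prec f) u v.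

Lemma adj_mask_sqr u v x : a u v * (a u v * x) ^+ 2 = a u v * x ^+ 2.
Proof.
transitivity (a u v * a u v * a u v * x ^+ 2); first by ring.
by rewrite !a_idem.
Qed.

Let sqnorm_ge0 f : 0 <= sqnorm f.
Proof.
by do 2!(apply: sumr_ge0 => ? _); rewrite mulr_ge0 ?sqr_ge0 ?adj_ge0.
Qed.

Let vertex_norm (g : 'I_n -> R) :
  \sum_u \sum_v a u v * g u ^+ 2 <= 2 * D * \sum_u g u ^+ 2.
Proof.
rewrite mulr_sumr; apply: ler_sum => u _.
by rewrite -mulr_suml; apply: ler_wpM2r (deg_le u); rewrite sqr_ge0.
Qed.

Let vertex_norm_sym (g : 'I_n -> R) :
  \sum_u \sum_v a u v * g v ^+ 2 = \sum_u \sum_v a u v * g u ^+ 2.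
Proof.
rewrite exchange_big; apply: eq_bigr => u _; apply: eq_bigr => v _.
by rewrite a_sym.
Qed.

Lemma rsum_norm f : \sum_u rsum f u ^+ 2 <= 2 * D * sqnorm f.
Proof.
rewrite mulr_sumr; apply: ler_sum => u _.
apply: le_trans (weighted_sum_sqr _ _ (a u) (f u) (adj_ge0 u)) _.
apply: ler_wpM2r (deg_le u); apply: sumr_ge0 => v _.
by rewrite mulr_ge0 ?sqr_ge0 ?adj_ge0.
Qed.

Lemma kap_norm f : n%:R * D * kap f ^+ 2 <= 2 / 9 * sqnorm f.
Proof.
have := sum_sqr _ _ (rsum f); rewrite card_ord => h.
have {}h := le_trans h (ler_wpM2l (ltW n_gt0) (rsum_norm f)).
rewrite /kap exprMn exprVn mulrA ler_pdivrMr; last by rewrite exprn_gt0// !mulr_gt0.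
have := ler_wpM2l (ltW (mulr_gt0 n_gt0 D_gt0)) h.
by rewrite (_ : 2 / 9 * _ * _ = n%:R * D * (n%:R * (2 * D * sqnorm f))); last by field.
Qed.

Let sqr_sum4 (x y z t : R) :
  (x + y + z + t) ^+ 2 <= 4 * (x ^+ 2 + y ^+ 2 + z ^+ 2 + t ^+ 2).
Proof.
have := sqr_ge0 (x - y); have := sqr_ge0 (x - z); have := sqr_ge0 (x - t).
have := sqr_ge0 (y - z); have := sqr_ge0 (y - t); have := sqr_ge0 (z - t).
by rewrite !sqrrB; lra.
Qed.

(** Each of the four terms of [prec] has squared norm at most [sqnorm f]; squaring a sum of four
    terms costs the other factor 4. *)
Lemma prec_norm f : sqnorm (prec f) <= 16 * sqnorm f.
Proof.
pose r u := rsum f u / (2 * D).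
have rnorm : \sum_u r u ^+ 2 <= sqnorm f / (2 * D).
  rewrite /r; under eq_bigr do rewrite exprMn.
  rewrite -mulr_suml exprVn ler_pdivrMr ?exprn_gt0 ?mulr_gt0//.
  apply: le_trans (rsum_norm f) _.
  by rewrite le_eqVlt; apply/orP; left; apply/eqP; field; rewrite gt_eqF.
have rn : \sum_u \sum_v a u v * r u ^+ 2 <= sqnorm f.
  apply: le_trans (vertex_norm r) _.
  by rewrite mulrC -ler_pdivlMr// mulr_gt0.
have kn : \sum_u \sum_v a u v * kap f ^+ 2 <= sqnorm f.
  apply: le_trans (vertex_norm (fun=> kap f)) _.
  rewrite sumr_const card_ord -mulr_natl.
  by have := kap_norm f; have := sqnorm_ge0 f; lra.
apply: le_trans (_ : 4 * (sqnorm f + \sum_u \sum_v a u v * r u ^+ 2 +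
   \sum_u \sum_v a u v * r v ^+ 2 + \sum_u \sum_v a u v * kap f ^+ 2) <= _); last first.
  by rewrite vertex_norm_sym; lra.
rewrite /sqnorm -!big_split mulr_sumr; apply: ler_sum => u _ /=.
rewrite -!big_split mulr_sumr; apply: ler_sum => v _ /=.
rewrite -!mulrDr [leRHS]mulrCA /prec adj_mask_sqr; apply: ler_wpM2l (adj_ge0 u v) _ _ _.
have := sqr_sum4 (f u v) (- r u) (- r v) (kap f).
rewrite !sqrrN; congr (is_true (_ ^+ 2 <= _)).
by rewrite /r; field; rewrite gt_eqF.
Qed.

Let beta : R := 3 * dl + 3 / D.
(** On an edge uv, [zed f u + zed f v] is what remains of f after subtracting the identity-plus-star
    operator applied to [prec f]: it measures how far P is from an exact inverse. *)
Let zed f u := rsum f u / (2 * D) - kap f / 2 - rsum (prec f) u / D.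

Lemma rsum_prec f u : rsum (prec f) u = rsum f u -
  (deg u * rsum f u + \sum_w a u w * rsum f w) / (2 * D) + deg u * kap f.
Proof.
rewrite {1}/rsum /prec; transitivity (\sum_w (a u w * f u w -
    (a u w * rsum f u + a u w * rsum f w) / (2 * D) + a u w * kap f)).
  by apply: eq_bigr => w _; rewrite mulrA a_idem; ring.
by rewrite big_split /= sumrB -!mulr_suml big_split /= -mulr_suml.
Qed.

Lemma zedE f u : zed f u = ((deg u / D - 1) * (rsum f u / 2 - D * kap f) +
  (\sum_w a u w * rsum f w - p * \sum_w rsum f w) / (2 * D)) / D.
Proof.
(* The normalisation of [kap] makes p times the total of [rsum f] equal to 3 D^2 kap, so both terms
   of [zed] become deviations: of a degree from D, and of A from pJ. *)
have sumE : p * \sum_w rsum f w = 3 * D ^+ 2 * kap f.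
  rewrite /kap (_ : 3 * D ^+ 2 = p * (3 * n%:R * D)); last by rewrite /D; ring.
  by rewrite -mulrA; congr (_ * _); rewrite [RHS]mulrC divfK// gt_eqF// !mulr_gt0.
rewrite sumE /zed rsum_prec; field.
by rewrite gt_eqF.
Qed.

Lemma zed_norm f :
  \sum_u \sum_v a u v * zed f u ^+ 2 <= 12 * (dl ^+ 2 + beta) * sqnorm f.
Proof.
pose x u := rsum f u; pose m u := \sum_w a u w * x w - p * \sum_w x w.
have beta_ge0 : 0 <= beta by apply: addr_ge0; [exact: mulr_ge0|exact: divr_ge0].
have zle u : zed f u ^+ 2 <= D ^- 2 * (dl ^+ 2 * (x u ^+ 2 + 4 * (D ^+ 2 * kap f ^+ 2)) +
    D ^- 2 / 2 * m u ^+ 2).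
  rewrite zedE -/(x u) -/(m u) expr_div_n mulrC ler_wpM2l ?invr_ge0 ?sqr_ge0//.
  pose y := deg u / D - 1; pose t := x u / 2 - D * kap f.
  apply: le_trans (_ : 2 * (y ^+ 2 * t ^+ 2) + 2 * (m u / (2 * D)) ^+ 2 <= _).
    rewrite -exprMn -/y -/t.
    by have := sqr_ge0 (y * t - m u / (2 * D)); rewrite sqrrB sqrrD; lra.
  have -> : D ^- 2 / 2 * m u ^+ 2 = 2 * (m u / (2 * D)) ^+ 2.
    by field; rewrite gt_eqF.
  rewrite lerD2r.
  have ydl := sqr_bound _ _ (deg_ratio u); rewrite -/y in ydl.
  have := ler_wpM2r (sqr_ge0 t) ydl.
  have tle : 2 * t ^+ 2 <= x u ^+ 2 + 4 * (D ^+ 2 * kap f ^+ 2).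
    rewrite -subr_ge0 (_ : _ - _ = 2 * (x u / 2 + D * kap f) ^+ 2); last by rewrite /t; field.
    by rewrite mulr_ge0 ?sqr_ge0.
  by have := ler_wpM2l (sqr_ge0 dl) tle; lra.
apply: le_trans (vertex_norm _) _.
apply: le_trans (ler_wpM2l _ (ler_sum _ (fun u _ => zle u))) _; first exact: mulr_ge0.
rewrite -mulr_sumr big_split /= -!mulr_sumr big_split /= sumr_const card_ord.
have mix := global_mixing x; rewrite -/(m _) -/beta in mix.
have xn := rsum_norm f; rewrite -/(x _) in xn.
have kn := kap_norm f.
set A := \sum_u x u ^+ 2 in mix xn *; set B := \sum_u _ in mix *.
have k' : 4 * (D ^+ 2 * kap f ^+ 2) *+ n = 4 * D * (n%:R * D * kap f ^+ 2).
  by rewrite -mulr_natl; ring.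
rewrite k'.
have h1 : A + 4 * D * (n%:R * D * kap f ^+ 2) <= 3 * D * sqnorm f.
  by have := ler_wpM2l (mulr_ge0 (ler0n _ 4) D_ge0) kn;
     have := mulr_ge0 D_ge0 (sqnorm_ge0 f); lra.
have h2 : D ^- 2 / 2 * B <= beta * D * sqnorm f.
  apply: le_trans (_ : D ^- 2 / 2 * (beta * D ^+ 2 * (2 * D * sqnorm f)) <= _).
    apply: ler_wpM2l; first by rewrite divr_ge0 ?invr_ge0 ?sqr_ge0.
    by apply: (le_trans mix); apply: ler_wpM2l => //; rewrite mulr_ge0 ?sqr_ge0.
  by rewrite le_eqVlt; apply/orP; left; apply/eqP; field; rewrite gt_eqF.
have h3 := lerD (ler_wpM2l (sqr_ge0 dl) h1) h2.
have c0 : 0 <= 2 * D * D ^- 2 by apply: divr_ge0; [exact: mulr_ge0|exact: sqr_ge0].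
rewrite [leLHS]mulrA; apply: le_trans (ler_wpM2l c0 h3) _.
rewrite [leLHS](_ : _ = (6 * dl ^+ 2 + 2 * beta) * sqnorm f); last first.
  by field; rewrite gt_eqF.
apply: ler_wpM2r => //.
by have := sqr_ge0 dl; lra.
Qed.

(** The factor 5 comes from squaring five terms. The others are 16 from [prec_norm], 32 = 2 * 16 for
    the mixing error in both orientations, and 24 = 2 * 12 for [zed] at both endpoints. *)
Let zeta2 : R := 5 * (16 * dl ^+ 2 + 32 * (8 * dl ^+ 2 + 2 * eta ^+ 2) +
  24 * (dl ^+ 2 + beta)).

Let beta_ge0 : 0 <= beta.
Proof. by apply: addr_ge0; [exact: mulr_ge0|exact: divr_ge0]. Qed.

Let zeta2_ge0 : 0 <= zeta2.
Proof. by rewrite /zeta2; have := sqr_ge0 dl; have := sqr_ge0 eta; have := beta_ge0; lra. Qed.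

Let sqr_sum5 (x y z t r : R) : (x + y + z + t + r) ^+ 2 <=
  5 * (x ^+ 2 + y ^+ 2 + z ^+ 2 + t ^+ 2 + r ^+ 2).
Proof.
have := sqr_ge0 (x - y); have := sqr_ge0 (x - z); have := sqr_ge0 (x - t).
have := sqr_ge0 (y - z); have := sqr_ge0 (y - t); have := sqr_ge0 (z - t).
have := sqr_ge0 (x - r); have := sqr_ge0 (y - r); have := sqr_ge0 (z - r).
have := sqr_ge0 (t - r).
by rewrite !sqrrB; lra.
Qed.

Lemma err_norm f : \sum_u \sum_v err f u v ^+ 2 <= zeta2 * sqnorm f.
Proof.
pose y := prec f.
pose e1 u v := - ((codeg u v / d - 1) * y u v).
pose e2 u v := tri y u v / d - rsum y u / D.
(* Three sources of error: the codegree in the diagonal term ([e1]), triangle sums against star sums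
   at either endpoint ([e2]), and the inexact inversion of the star operator ([zed]). *)
have errE u v : err f u v =
    a u v * (e1 u v + (- e2 u v) + (- e2 v u) + zed f u + zed f v).
  rewrite /err /lap -/y.
  have -> : a u v * f u v = a u v * (y u v + (rsum f u + rsum f v) / (2 * D) - kap f).
    by rewrite /y /prec; have [/eqP->|/eqP->] := orP (adj01 u v); ring.
  by rewrite /e1 /e2 /zed -/y; field; rewrite !gt_eqF.
have err2 u v : err f u v ^+ 2 <= 5 * (a u v * e1 u v ^+ 2 + a u v * e2 u v ^+ 2 +
    a u v * e2 v u ^+ 2 + a u v * zed f u ^+ 2 + a u v * zed f v ^+ 2).
  rewrite errE exprMn [a u v ^+ 2]expr2 a_idem -!mulrDr [leRHS]mulrCA.
  apply: ler_wpM2l (adj_ge0 u v) _ _ _.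
  by rewrite -[X in _ <= _ * (_ + X + _ + _ + _)]sqrrN
     -[X in _ <= _ * (_ + X + _ + _)]sqrrN; exact: sqr_sum5.
apply: le_trans (ler_sum _ (fun u _ => ler_sum _ (fun v _ => err2 u v))) _.
under eq_bigr do rewrite -mulr_sumr !big_split /=.
rewrite -mulr_sumr !big_split /= /zeta2 -[leRHS]mulrA.
apply: ler_wpM2l => //.
have n1 : \sum_u \sum_v a u v * e1 u v ^+ 2 <= dl ^+ 2 * sqnorm y.
  rewrite mulr_sumr; apply: ler_sum => u _; rewrite mulr_sumr; apply: ler_sum => v _.
  have [/eqP->|/eqP uv] := orP (adj01 u v); first by rewrite !mul0r mulr0.
  rewrite uv !mul1r /e1 sqrrN exprMn; apply: ler_wpM2r; first exact: sqr_ge0.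
  exact: sqr_bound (codeg_ratio _ _ (adj_neq _ _ uv)).
have n2 : \sum_u \sum_v a u v * e2 u v ^+ 2 <= (8 * dl ^+ 2 + 2 * eta ^+ 2) * sqnorm y.
  by rewrite mulr_sumr; apply: ler_sum => u _; exact: neighborhood_mixing.
have n3 : \sum_u \sum_v a u v * e2 v u ^+ 2 = \sum_u \sum_v a u v * e2 u v ^+ 2.
  by rewrite exchange_big; do 2!(apply: eq_bigr => ? _); rewrite a_sym.
have n5 := vertex_norm_sym (zed f).
have n4 := zed_norm f.
have yn : sqnorm y <= 16 * sqnorm f := prec_norm f.
have c1 := ler_wpM2l (sqr_ge0 dl) yn.
have c20 : 0 <= 8 * dl ^+ 2 + 2 * eta ^+ 2 by have := sqr_ge0 dl; have := sqr_ge0 eta; lra.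
have c2 := ler_wpM2l c20 yn.
rewrite n3 n5; lra.
Qed.

(** * Linearity, sup-norm bounds and the Neumann series *)

Lemma lin_rsum f1 f2 f3 c : (forall u v, f3 u v = c * f1 u v + f2 u v) ->
  forall u, rsum f3 u = c * rsum f1 u + rsum f2 u.
Proof.
move=> fE u; rewrite /rsum mulr_sumr -big_split; apply: eq_bigr => w _ /=.
by rewrite fE; ring.
Qed.

Lemma lin_tri f1 f2 f3 c : (forall u v, f3 u v = c * f1 u v + f2 u v) ->
  forall u v, tri f3 u v = c * tri f1 u v + tri f2 u v.
Proof.
move=> fE u v; rewrite /tri mulr_sumr -big_split; apply: eq_bigr => w _ /=.
by rewrite fE; ring.
Qed.

Lemma lin_prec f1 f2 f3 c : (forall u v, f3 u v = c * f1 u v + f2 u v) ->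
  forall u v, prec f3 u v = c * prec f1 u v + prec f2 u v.
Proof.
move=> fE u v; have rE := lin_rsum _ _ _ _ fE.
have kE : kap f3 = c * kap f1 + kap f2.
  rewrite /kap mulrA -mulrDl mulr_sumr -big_split; congr (_ / _).
  by apply: eq_bigr => w _; exact: rE.
by rewrite /prec fE !rE kE; ring.
Qed.

Lemma lin_err f1 f2 f3 c : (forall u v, f3 u v = c * f1 u v + f2 u v) ->
  forall u v, err f3 u v = c * err f1 u v + err f2 u v.
Proof.
move=> fE u v; have pE := lin_prec _ _ _ _ fE.
by rewrite /err /lap fE pE !(lin_tri _ _ _ _ pE); ring.
Qed.

Let norm_wsum_le (w x : 'I_n -> R) (W B : R) : (forall i, 0 <= w i) ->
  \sum_i w i <= W -> 0 <= B -> (forall i, `|x i| <= B) ->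
  `|\sum_i w i * x i| <= W * B.
Proof.
move=> w0 wW B0 xB; apply: le_trans (ler_norm_sum _ _ _) _.
apply: le_trans (_ : \sum_i w i * B <= _).
  by apply: ler_sum => i _; rewrite normrM ger0_norm// ler_wpM2l.
by rewrite -mulr_suml; apply: ler_wpM2r.
Qed.

Lemma prec_sup f B : (forall u v, `|f u v| <= B) -> forall u v, `|prec f u v| <= 4 * B.
Proof.
move=> fB u v; have B0 : 0 <= B by exact: le_trans (fB u v).
have rB w : `|rsum f w| <= 2 * D * B.
  by apply: norm_wsum_le (adj_ge0 w) (deg_le w) B0 _ => x; exact: fB.
have h1 : `|(rsum f u + rsum f v) / (2 * D)| <= 2 * B.
  rewrite normrM normfV (gtr0_norm (_ : 0 < 2 * D)) ?mulr_gt0//.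
  rewrite ler_pdivrMr ?mulr_gt0//; apply: le_trans (ler_normD _ _) _.
  by have := rB u; have := rB v; lra.
have h2 : `|kap f| <= B.
  rewrite /kap normrM normfV (gtr0_norm (_ : 0 < 3 * n%:R * D)) ?mulr_gt0//.
  rewrite ler_pdivrMr ?mulr_gt0//; apply: le_trans (ler_norm_sum _ _ _) _.
  apply: le_trans (ler_sum _ (fun w _ => rB w)) _.
  rewrite sumr_const card_ord -mulr_natl.
  have : 0 <= n%:R * (D * B) by rewrite mulr_ge0 ?mulr_ge0// ltW.
  lra.
rewrite /prec normrM (ger0_norm (adj_ge0 _ _)).
apply: le_trans (_ : `|f u v - (rsum f u + rsum f v) / (2 * D) + kap f| <= _).
  by apply: ler_piMl => //; exact: adj_le1.
apply: le_trans (ler_normD _ _) _; apply: le_trans (lerD (ler_normB _ _) (lexx _)) _.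
by have := fB u v; lra.
Qed.

(** The constant is 25 = 1 + 3 * 2 * 4: f itself, and three sums with total weight at most 2 d,
    divided by d, of values that [prec] enlarges at most 4 times. *)
Lemma err_sup f B : (forall u v, `|f u v| <= B) -> forall u v, `|err f u v| <= 25 * B.
Proof.
move=> fB u v; have B0 : 0 <= B by exact: le_trans (fB u v).
have [/eqP uv|/eqP uv] := orP (adj01 u v).
  by rewrite /err /lap uv !mul0r subrr normr0 mulr_ge0.
have pB := prec_sup _ _ fB; have B40 : 0 <= 4 * B by rewrite mulr_ge0.
have cB := codeg_le _ _ (adj_neq _ _ uv); set y := prec f in pB *.
have tB u' v' : u' != v' -> `|tri y u' v'| <= 2 * d * (4 * B).
  move=> uv'; apply: norm_wsum_le (codeg_le _ _ uv') B40 _ => w //.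
  by rewrite mulr_ge0 ?adj_ge0.
have h1 := tB _ _ (adj_neq _ _ uv).
have h2 : `|tri y v u| <= 2 * d * (4 * B) by apply: tB; rewrite eq_sym adj_neq.
have h3 : `|codeg u v * y u v| <= 2 * d * (4 * B).
  by rewrite normrM (ger0_norm (codeg_ge0 u v)); apply: ler_pM => //; exact: codeg_ge0.
rewrite /err /lap -/y uv !mul1r; apply: le_trans (ler_normB _ _) _.
have : `|(codeg u v * y u v + tri y u v + tri y v u) / d| <= 24 * B.
  rewrite normrM normfV (gtr0_norm d_gt0) ler_pdivrMr//.
  apply: le_trans (ler_normD _ _) _; apply: le_trans (lerD (ler_normD _ _) (lexx _)) _.
  by lra.
by have := fB u v; lra.
Qed.

(** No limit is taken: since [err] contracts the L2 norm, 1 - err is injective on the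
    finite-dimensional space of matrices, hence invertible. *)
Lemma err_fixpoint f : zeta2 < 1 -> exists g, forall u v, g u v = f u v + err g u v.
Proof.
move=> zeta_lt1.
pose Q (M : 'M[R]_n) := \matrix_(u, v) (M u v - err M u v).
have Qlin : linear Q.
  move=> c M N; apply/matrixP => u v; rewrite !mxE.
  rewrite (lin_err M N _ c) => [|u' v']; last by rewrite !mxE.
  by ring.
pose Qlinear := GRing.isLinear.Build _ _ _ _ Q Qlin.
pose Q' : {linear 'M[R]_n -> 'M[R]_n} := HB.pack Q Qlinear.
pose F := linfun Q'.
have Q_inj : lker F == 0%VS.
  apply/eqP/eqP; rewrite -subv0; apply/subvP => M; rewrite memv_ker lfunE /= => /eqP QM.
  have eM u v : M u v = err M u v.
    by move/matrixP/(_ u v): QM; rewrite !mxE => /eqP; rewrite subr_eq0 => /eqP.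
  have nM : \sum_u \sum_v M u v ^+ 2 <= zeta2 * \sum_u \sum_v M u v ^+ 2.
    rewrite [leLHS](_ : _ = \sum_u \sum_v err M u v ^+ 2); last first.
      by do 2!(apply: eq_bigr => ? _); rewrite eM.
    apply: le_trans (err_norm M) _; apply: ler_wpM2l => //.
    do 2!(apply: ler_sum => ? _); apply: ler_piMl; [exact: sqr_ge0|exact: adj_le1].
  have sq0 u : 0 <= \sum_v M u v ^+ 2 by apply: sumr_ge0 => v _; exact: sqr_ge0.
  have : \sum_u \sum_v M u v ^+ 2 = 0.
    apply/eqP; rewrite eq_le sumr_ge0 ?andbT// -(ler_pM2l (_ : 0 < 1 - zeta2)) ?subr_gt0//.
    by rewrite mulr0 mulrBl mul1r subr_le0.
  move=> /eqP; rewrite psumr_eq0// => /allP M0.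
  rewrite memv0; apply/eqP/matrixP => u v; rewrite mxE.
  have := M0 u (mem_index_enum _); rewrite /= psumr_eq0 => [|? _]; last exact: sqr_ge0.
  by move=> /allP/(_ v (mem_index_enum _)); rewrite sqrf_eq0 => /eqP.
pose r : 'M[R]_n := \matrix_(u, v) f u v.
exists (fun_of_matrix ((F^-1)%VF r)) => u v.
have /matrixP/(_ u v) : F ((F^-1)%VF r) = r by rewrite lker0_lfunVK.
by rewrite lfunE /= !mxE => /eqP; rewrite subr_eq => /eqP.
Qed.

Let full_norm f := \sum_u \sum_v f u v ^+ 2.

Let full_norm_ge0 f : 0 <= full_norm f.
Proof. by do 2!(apply: sumr_ge0 => ? _); exact: sqr_ge0. Qed.

Let err_full_norm f : full_norm (err f) <= zeta2 * full_norm f.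
Proof.
apply: le_trans (err_norm f) _; apply: ler_wpM2l => //.
by do 2!(apply: ler_sum => ? _); apply: ler_piMl; [exact: sqr_ge0|exact: adj_le1].
Qed.

Let full_norm_coef f u v : f u v ^+ 2 <= full_norm f.
Proof.
rewrite /full_norm (bigD1 u)//= (bigD1 v)//= -addrA lerDl addr_ge0//.
  by apply: sumr_ge0 => w _; exact: sqr_ge0.
by do 2!(apply: sumr_ge0 => ? _); exact: sqr_ge0.
Qed.

Lemma iter_err_lin k f1 f2 f3 : (forall u v, f3 u v = f1 u v + f2 u v) ->
  forall u v, iter k err f3 u v = iter k err f1 u v + iter k err f2 u v.
Proof.
elim: k => //= k IH fE u v.
by rewrite (lin_err (iter k err f1) (iter k err f2) _ 1) ?mul1r// => ? ?; rewrite mul1r IH.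
Qed.

Lemma iter_err_sup k f B : (forall u v, `|f u v| <= B) ->
  forall u v, `|iter k err f u v| <= 25 ^+ k * B.
Proof.
move=> fB; elim: k => [|k IH] u v /=; first by rewrite mul1r.
by rewrite exprS -mulrA; exact: err_sup.
Qed.

Lemma iter_err_norm k f : full_norm (iter k err f) <= zeta2 ^+ k * full_norm f.
Proof.
elim: k => [|k IH] /=; first by rewrite mul1r.
by apply: le_trans (err_full_norm _) _; rewrite exprS -mulrA; apply: ler_wpM2l.
Qed.

Let sqr_sum2 (x y : R) : (x + y) ^+ 2 <= 2 * x ^+ 2 + 2 * y ^+ 2.
Proof. by have := sqr_ge0 (x - y); rewrite sqrrB sqrrD; lra. Qed.

(* g = f + err f + ... + err^(K-1) f + err^K g: the first K terms are bounded in sup norm, the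
   last one in L2 norm. *)
Lemma fixpoint_sup (K : nat) (c : R) f g : zeta2 <= 1 / 4 -> 0 <= c ->
  4 * n%:R ^+ 2 * zeta2 ^+ K <= c ^+ 2 ->
  (forall u v, `|f u v| <= dl) -> (forall u v, g u v = f u v + err g u v) ->
  forall u v, `|g u v| <= K%:R * 25 ^+ K * dl + c.
Proof.
move=> zeta_le c0 cK fdl gE.
have head k u v : `|g u v - iter k err g u v| <= k%:R * 25 ^+ k * dl.
  elim: k => [|k IH]; first by rewrite /= subrr normr0 !mul0r.
  have step : iter k err g u v = iter k err f u v + iter k.+1 err g u v.
    by rewrite iterSr; exact: iter_err_lin.
  rewrite (_ : _ - _ = (g u v - iter k err g u v) + iter k err f u v); last by rewrite step; ring.
  apply: le_trans (ler_normD _ _) _.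
  apply: le_trans (lerD IH (iter_err_sup k _ _ fdl u v)) _.
  have e0 : 0 <= 25 ^+ k * dl by rewrite mulr_ge0 ?exprn_ge0.
  have k0 : 0 <= k%:R * (25 ^+ k * dl) by rewrite mulr_ge0 ?ler0n.
  rewrite exprS -[k.+1%:R]natr1; lra.
have fnorm : full_norm f <= n%:R ^+ 2.
  apply: le_trans (_ : \sum_(u < n) \sum_(v < n) 1 <= _).
    apply: ler_sum => u _; apply: ler_sum => v _; rewrite -(expr1n _ 2); apply: sqr_bound.
    by apply: le_trans (fdl u v) _; have := dl_le; lra.
  by rewrite sumr_const card_ord sumr_const card_ord -[leLHS]mulr_natl expr2.
(* From g = f + err g, |g|^2 <= 2 |f|^2 + 2 zeta2 |g|^2, and zeta2 <= 1 / 4 lets the last term be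
   absorbed. *)
have gnorm : full_norm g <= 4 * n%:R ^+ 2.
  have h : full_norm g <= 2 * full_norm f + 2 * full_norm (err g).
    rewrite /full_norm !mulr_sumr -big_split; apply: ler_sum => u _ /=.
    rewrite !mulr_sumr -big_split; apply: ler_sum => v _ /=.
    by rewrite gE; exact: sqr_sum2.
  have h2 := err_full_norm g; have h3 := ler_wpM2r (full_norm_ge0 g) zeta_le.
  lra.
move=> u v; have tail : `|iter K err g u v| <= c.
  rewrite -(ler_pXn2r (_ : 0 < 2)%N) ?nnegrE// real_normK ?num_real//.
  apply: le_trans (full_norm_coef _ u v) _; apply: le_trans (iter_err_norm K g) _.
  apply: le_trans (ler_wpM2l _ gnorm) _; first exact: exprn_ge0.
  by rewrite mulrC.
rewrite -(subrK (iter K err g u v) (g u v)).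
by apply: le_trans (ler_normD _ _) _; exact: lerD.
Qed.

(** The weights are 1 / 3 + prec g on edges. The constant 1 / 3 leaves the residue f = 1 - L(1 / 3)
    = 1 - codeg / d, and the fixed point g = f + err g says that L (prec g) = f on edges. The factor
    12 = 4 * 3 makes |prec g| <= 1 / 3, hence nonnegative weights. *)
Lemma triangle_weights (K : nat) (c : R) : zeta2 <= 1 / 4 -> 0 <= c ->
  4 * n%:R ^+ 2 * zeta2 ^+ K <= c ^+ 2 -> 12 * (K%:R * 25 ^+ K * dl + c) <= 1 ->
  exists Y : 'I_n -> 'I_n -> R, [/\ forall u v, 0 <= Y u v, forall u v, Y u v = Y v u,
    forall u, Y u u = 0 &
    forall u v, a u v = 1 ->
      \sum_w a u w * a v w * (Y u v + Y u w + Y v w) = d].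
Proof.
move=> zeta_le c0 cK sup_le.
pose f u v := a u v * (1 - codeg u v / d).
have fdl u v : `|f u v| <= dl.
  rewrite /f; have [/eqP->|/eqP uv] := orP (adj01 u v); first by rewrite mul0r normr0.
  by rewrite uv mul1r distrC; exact: codeg_ratio (adj_neq _ _ uv).
have zeta_lt1 : zeta2 < 1 by lra.
have [g gE] := err_fixpoint f zeta_lt1.
have gsup := fixpoint_sup K c f g zeta_le c0 cK fdl gE.
have psup u v : `|prec g u v| <= 1 / 3.
  by apply: le_trans (prec_sup _ _ gsup u v) _; lra.
have codegC u v : codeg u v = codeg v u by apply: eq_bigr => w _; rewrite mulrC.
have solves u v : a u v = 1 ->
    codeg u v * prec g u v + tri (prec g) u v + tri (prec g) v u = d - codeg u v.
  move=> uv; have := gE u v; rewrite /err /lap /f uv !mul1r => h.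
  have {h} : (codeg u v * prec g u v + tri (prec g) u v + tri (prec g) v u) / d =
     1 - codeg u v / d by lra.
  move=> /(congr1 ( *%R^~ d)); rewrite divfK ?gt_eqF// => ->.
  by rewrite mulrBl mul1r divfK// gt_eqF.
(* The equations at (u, v) and at (v, u) contain the same two [tri] terms and the same right-hand
   side, so they differ only in the diagonal term, whose coefficient codeg u v is positive. *)
have psym u v : prec g u v = prec g v u.
  have [/eqP uv|/eqP uv] := orP (adj01 u v).
    by rewrite /prec (a_sym v u) uv !mul0r.
  have h1 := solves u v uv; have h2 : a v u = 1 by rewrite a_sym.
  have {h2} h2 := solves v u h2.
  have cgt0 : 0 < codeg u v.
    have := codeg_approx u v (adj_neq _ _ uv); rewrite ler_norml => /andP[h _].
    have : dl * d <= 1 / 2 * d by rewrite ler_pM2r.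
    by have := d_gt0; lra.
  apply: (mulfI (lt0r_neq0 cgt0)); rewrite (codegC v u) in h2; lra.
exists (fun u v => a u v * (1 / 3 + prec g u v)); split => [u v|u v|u|u v uv].
- apply: mulr_ge0; first exact: adj_ge0.
  by have := psup u v; rewrite ler_norml => /andP[]; lra.
- by rewrite psym a_sym.
- by rewrite a_irr mul0r.
have -> : d = codeg u v + (codeg u v * prec g u v + tri (prec g) u v + tri (prec g) v u).
  by rewrite solves// addrC subrK.
rewrite /tri /codeg mulr_suml -!big_split; apply: eq_bigr => w _ /=.
rewrite uv; have [/eqP->|/eqP->] := orP (adj01 u w); have [/eqP->|/eqP->] := orP (adj01 v w); lra.
Qed.

End Pseudorandom.

(** * Exponential moments when part of the edges is exposed first *)

Lemma expR_le_quadratic (R : realType) (x : R) : x <= 1 / 2 ->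
  expR x <= 1 + x + 2 * x ^+ 2.
Proof.
move=> x2.
have e1 : 1 - x <= expR (- x) by exact: expR_ge1Dx.
have e2 : expR x * expR (- x) = 1 by rewrite -expRD subrr expR0.
have e3 : expR x * (1 - x) <= 1.
  by rewrite -[leRHS]e2; apply: ler_wpM2l => //; exact: expR_ge0.
(* It suffices to multiply by 1 - x, as (1 - x) (1 + x + 2 x^2) = 1 + x^2 (1 - 2 x) >= 1. *)
rewrite -(ler_pM2r (_ : 0 < 1 - x)); last by lra.
apply: (le_trans e3); rewrite -subr_ge0.
rewrite (_ : _ - _ = x ^+ 2 * (1 - 2 * x)); last by ring.
by rewrite mulr_ge0 ?sqr_ge0//; lra.
Qed.

Section Exposure.
Variables (R : realType) (n : nat) (p : R).
Hypothesis p01 : 0 <= p <= 1.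
Notation edge := {set 'I_n}.
Notation graph := {set {set 'I_n}}.
Implicit Types (E J : graph) (e : edge).
Let K := potential_edges n.
Let p_ge0 : 0 <= p. Proof. by case/andP: p01. Qed.
Let q_ge0 : 0 <= 1 - p. Proof. by case/andP: p01; rewrite subr_ge0. Qed.

Lemma gnp_mass_ge0 E : 0 <= gnp_mass p E.
Proof. by apply: prodr_ge0 => e _; case: ifP. Qed.

Let coin E e : R := if e \in E then p else 1 - p.

Lemma sum_subsets_prod (A : graph) (x y : edge -> R) :
  \sum_(E in powerset A) \prod_(e in A) (if e \in E then x e else y e) =
  \prod_(e in A) (x e + y e).
Proof.
pose F e := if e \in A then x e else 0; pose G e := if e \in A then y e else 1.
transitivity (\prod_e (F e + G e)); last first.
  rewrite [RHS]big_mkcond; apply: eq_bigr => e _; rewrite /F /G.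
  by case: ifP => //; rewrite add0r.
rewrite bigA_distr [RHS](bigID (mem (powerset A))) /= [X in _ = _ + X]big1 ?addr0.
  apply: eq_bigr => E; rewrite powersetE => /fintype.subsetP EA.
  rewrite big_mkcond; apply: eq_bigr => e _ /=; rewrite /F /G.
  by case: ifP => eA //; case: ifP => // /EA; rewrite eA.
move=> E; rewrite powersetE => /fintype.subsetPn[e eE eA].
by rewrite (bigD1 e)//= eE /F (negbTE eA) mul0r.
Qed.

(* Conditioning on E :&: A, the edges outside A are independent. *)
Lemma exposure_prod (A : graph) (x y : graph -> edge -> R) :
  A \subset K ->
  (forall J e, 0 <= x J e) -> (forall J e, 0 <= y J e) ->
  (forall J e, e \in K :\: A -> p * x J e + (1 - p) * y J e <= 1) ->
  \sum_(E in powerset K) gnp_mass p E *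
    \prod_(e in K :\: A) (if e \in E then x (E :&: A) e else y (E :&: A) e) <= 1.
Proof.
move=> AK x0 y0 xy1.
rewrite (partition_big (fun E => E :&: A) (mem (powerset A))) /=; last first.
  by move=> E _; rewrite powersetE subsetIr.
apply: le_trans (_ : \sum_(J in powerset A) \prod_(e in A) coin J e <= _); last first.
  rewrite sum_subsets_prod big1// => e _.
  by rewrite addrC subrK.
apply: ler_sum => J; rewrite powersetE => /fintype.subsetP JA.
have coin_ge0 e : 0 <= coin J e by rewrite /coin; case: ifP.
(* On A these factors vanish unless E agrees with J there, so the expansion of the product of F + G
   keeps only the graphs with E :&: A = J. *)
pose F e := if e \in A then (if e \in J then p else 0) else p * x J e.
pose G e := if e \in A then (if e \in J then 0 else 1 - p) else (1 - p) * y J e.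
have F0 e : 0 <= F e by rewrite /F; case: ifP => _; [case: ifP|exact: mulr_ge0].
have G0 e : 0 <= G e by rewrite /G; case: ifP => _; [case: ifP|exact: mulr_ge0].
have splitK (H : edge -> R) :
    \prod_(e in K) H e = \prod_(e in A) H e * \prod_(e in K :\: A) H e.
  rewrite (bigID (mem A)) /=; congr (_ * _); apply: eq_bigl => e.
    by case: (boolP (e \in A)) => [/(fintype.subsetP AK)->|]; rewrite ?andbF.
  by rewrite finset.in_setD andbC.
apply: le_trans (_ : \sum_(E in powerset K) \prod_(e in K) (if e \in E then F e else G e) <= _).
  rewrite [leLHS]big_mkcondr; apply: ler_sum => E _; case: ifP => [/eqP EJ|_]; last first.
    by apply: prodr_ge0 => e _; case: ifP.
  rewrite EJ /gnp_mass -/K !splitK -mulrA -big_split /= le_eqVlt; apply/orP; left.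
  apply/eqP; congr (_ * _); apply: eq_bigr => e; rewrite /F /G.
    move=> eA; rewrite eA -EJ inE eA andbT.
    by case: ifP.
  by rewrite finset.in_setD => /andP[/negbTE-> _]; case: ifP.
rewrite sum_subsets_prod splitK -[leRHS]mulr1; apply: ler_pM.
- by apply: prodr_ge0 => e _; apply: addr_ge0.
- by apply: prodr_ge0 => e _; apply: addr_ge0.
- apply: ler_prod => e eA; rewrite addr_ge0//= /F /G /coin eA.
  by case: ifP; rewrite ?addr0 ?add0r.
- apply: prodr_ile1 => e eKA; rewrite addr_ge0//= /F /G.
  by have := eKA; rewrite finset.in_setD => /andP[/negbTE-> _]; exact: xy1.
Qed.

(** Markov's inequality, with W a nonnegative majorant of the indicator of B. *)
Lemma le_gnp_prob_wsum (B : graph -> Prop) (W : graph -> R) :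
  (forall E, 0 <= W E) -> (forall E, E \subset K -> B E -> 1 <= W E) ->
  gnp_prob p B <= \sum_(E in powerset K) gnp_mass p E * W E.
Proof.
move=> W0 W1; rewrite /gnp_prob big_mkcondr; apply: ler_sum => E; rewrite powersetE => EK.
case: asboolP => [BE|_]; last by rewrite mulr_ge0 ?gnp_mass_ge0.
by rewrite ler_peMr ?gnp_mass_ge0 ?W1.
Qed.

Section Tail.
Variables (A : graph) (al : graph -> edge -> R).
Hypothesis AK : A \subset K.
Hypothesis al_ge0 : forall J e, 0 <= al J e.
Hypothesis al_le2 : forall J e, e \in K :\: A -> al J e <= 2.
Let S E := \sum_(e in K :\: A) al (E :&: A) e * (e \in E)%:R.
(** The conditional mean of [S E] given the exposed part E :&: A; it is itself random. *)
Let mu E := p * \sum_(e in K :\: A) al (E :&: A) e.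

(** An unexposed edge with coefficient al contributes at most exp(p (t al + 2 (t al)^2)), by the
    quadratic bound, available since t al <= 1 / 2. As al <= 2, 2 al^2 <= 4 al, so the correction 4
    t^2 mu compensates the second-order term. *)
Lemma exposure_exp t : `|t| <= 1 / 4 ->
  \sum_(E in powerset K) gnp_mass p E * expR (t * (S E - mu E) - 4 * t ^+ 2 * mu E) <= 1.
Proof.
move=> t4.
pose c J e := - t * al J e * p - 4 * p * t ^+ 2 * al J e.
pose x J e := expR (t * al J e + c J e); pose y J e := expR (c J e).
have xy1 J e : e \in K :\: A -> p * x J e + (1 - p) * y J e <= 1.
  move=> eKA; have a0 := al_ge0 J e; have a2 := al_le2 J e eKA.
  have ta : t * al J e <= 1 / 2.
    apply: le_trans (ler_norm _) _; rewrite normrM (ger0_norm a0).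
    by apply: le_trans (ler_pM _ _ t4 a2) _ => //; lra.
  have h1 : p * expR (t * al J e) + (1 - p) <=
      expR (p * (t * al J e + 2 * (t * al J e) ^+ 2)).
    apply: le_trans (expR_ge1Dx _).
    have := ler_wpM2l p_ge0 (expR_le_quadratic _ _ ta); lra.
  have -> : p * x J e + (1 - p) * y J e =
      (p * expR (t * al J e) + (1 - p)) * expR (c J e).
    by rewrite /x /y expRD; ring.
  apply: le_trans (ler_wpM2r (expR_ge0 _) h1) _.
  rewrite -expRD -[leRHS]expR0 ler_expR /c.
  have : 0 <= p * t ^+ 2 * (al J e * (2 - al J e)).
    apply: mulr_ge0; apply: mulr_ge0 => //; first exact: sqr_ge0.
    by rewrite subr_ge0.
  lra.
have := exposure_prod A x y AK (fun _ _ => expR_ge0 _) (fun _ _ => expR_ge0 _) xy1.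
congr (is_true (_ <= _)); apply: eq_bigr => E _; congr (_ * _).
have -> : t * (S E - mu E) - 4 * t ^+ 2 * mu E = \sum_(e in K :\: A)
    (if e \in E then t * al (E :&: A) e + c (E :&: A) e else c (E :&: A) e).
  rewrite /S /mu mulrBr !mulr_sumr -!sumrB; apply: eq_bigr => e _.
  by rewrite /c; case: ifP => _; rewrite ?mulr1 ?mulr0; ring.
by rewrite expR_sum; apply: eq_bigr => e _; rewrite /x /y; case: ifP.
Qed.

Lemma exposure_tail (lam V : R) : 0 < lam -> lam <= 2 * V ->
  gnp_prob p (fun E => lam <= `|S E - mu E| /\ mu E <= V) <=
  2 * expR (- (lam ^+ 2 / (16 * V))).
Proof.
move=> lam0 lamV; have V0 : 0 < V by lra.
(* This t maximises t lam - 4 t^2 V, with value lam^2 / (16 V); the hypothesis lam <= 2 V is t <= 1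
   / 4. The two tails use t and -t. *)
pose t := lam / (8 * V).
have t0 : 0 <= t by rewrite divr_ge0 ?ltW// mulr_gt0.
have t4 : t <= 1 / 4 by rewrite ler_pdivrMr ?mulr_gt0//; lra.
pose W s E := expR (s * (S E - mu E) - 4 * s ^+ 2 * mu E).
apply: le_trans (le_gnp_prob_wsum _
  (fun E => (W t E + W (- t) E) * expR (- (lam ^+ 2 / (16 * V)))) _ _) _.
- by move=> E; rewrite mulr_ge0 ?addr_ge0 ?expR_ge0.
- move=> E _ [lamS muV].
  have big s : s * (S E - mu E) = t * `|S E - mu E| -> s ^+ 2 = t ^+ 2 ->
      1 <= W s E * expR (- (lam ^+ 2 / (16 * V))).
    move=> sE s2; rewrite /W -expRD -[leLHS]expR0 ler_expR sE s2.
    have h1 := ler_wpM2l t0 lamS.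
    have h2 := ler_wpM2l (sqr_ge0 t) muV.
    have -> : lam ^+ 2 / (16 * V) = t * lam - 4 * (t ^+ 2 * V).
      by rewrite /t; field; rewrite gt_eqF.
    lra.
  have pos s : 0 <= W s E * expR (- (lam ^+ 2 / (16 * V))) by rewrite mulr_ge0 ?expR_ge0.
  rewrite mulrDl; have := pos t; have := pos (- t).
  have [h|h] := ger0P (S E - mu E).
    by have := big t; rewrite (ger0_norm h) => /(_ erefl erefl); lra.
  by have := big (- t); rewrite (ltr0_norm h) mulrN mulNr sqrrN => /(_ erefl erefl); lra.
under eq_bigr do rewrite mulrA mulrDr.
rewrite -mulr_suml big_split /=; apply: ler_wpM2r; first exact: expR_ge0.
have h1 := exposure_exp t; have h2 := exposure_exp (- t).
rewrite normrN ger0_norm// in h2; rewrite ger0_norm// in h1.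
by have := h1 t4; have := h2 t4; rewrite /W; lra.
Qed.

End Tail.

Lemma le_gnp_prob (B B' : graph -> Prop) :
  (forall E, E \subset K -> B E -> B' E) -> gnp_prob p B <= gnp_prob p B'.
Proof.
move=> BB'; rewrite /gnp_prob [leLHS]big_mkcondr [leRHS]big_mkcondr.
apply: ler_sum => E; rewrite powersetE => EK.
case: asboolP => [/(BB' _ EK) B'E|_]; first by rewrite asboolT.
by case: ifP => // _; exact: gnp_mass_ge0.
Qed.

Definition adj E (u v : 'I_n) : R := ([set u; v]%SET \in E)%:R.

Section Bilinear.
Variables (U : {set 'I_n}) (X Y : graph -> 'I_n -> R).
(** The edges meeting U are exposed first. X and Y depend only on them and vanish on U, so the
    bilinear form sees only unexposed edges. *)
Let A : graph := [set e in K | ~~ [disjoint e & U]]%SET.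
Hypothesis X01 : forall J x, 0 <= X J x <= 1.
Hypothesis Y01 : forall J x, 0 <= Y J x <= 1.
Hypothesis XU : forall J x, x \in U -> X J x = 0.
Hypothesis YU : forall J x, x \in U -> Y J x = 0.
Hypothesis XA : forall E x, X E x = X (E :&: A) x.
Hypothesis YA : forall E x, Y E x = Y (E :&: A) x.
Let S E := \sum_x \sum_y X E x * Y E y * adj E x y.
Let mu E := p * \sum_x \sum_(y | y != x) X E x * Y E y.
(** The coefficient of the edge e in the bilinear form. An edge arises from two ordered pairs,
    whence the bound 2 below; loops are not edges, which is why [mu] omits y = x. *)
Let al J e := \sum_x \sum_y ([set x; y]%SET == e)%:R * (X J x * Y J y).

Let X_ge0 J x : 0 <= X J x. Proof. by case/andP: (X01 J x). Qed.
Let Y_ge0 J x : 0 <= Y J x. Proof. by case/andP: (Y01 J x). Qed.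

Let al_ge0 J e : 0 <= al J e.
Proof. by do 2!(apply: sumr_ge0 => ? _); rewrite mulr_ge0 ?ler0n ?mulr_ge0. Qed.

Let al_le2 J e : e \in K :\: A -> al J e <= 2.
Proof.
move=> /setDP[]; rewrite inE => /eqP e2 _.
have card_sum (B : {set 'I_n}) : \sum_x (x \in B)%:R = #|B|%:R :> R.
  by rewrite -natr_sum -sum1_card [in RHS]big_mkcond.
apply: le_trans (_ : \sum_x (x \in e)%:R <= _); last by rewrite card_sum e2.
apply: ler_sum => x _; have [xe|xe] := boolP (x \in e); last first.
  rewrite big1// => y _; case: eqP => [xye|_]; last by rewrite mul0r.
  by rewrite -xye !inE eqxx in xe.
have ex1 : #|e :\ x| = 1%N by move: e2; rewrite (cardsD1 x e) xe => -[].
apply: le_trans (_ : \sum_y (y \in e :\ x)%:R <= _); last by rewrite card_sum ex1.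
apply: ler_sum => y _; case: eqP => [xye|_]; last by rewrite mul0r ler0n.
have -> : y \in e :\ x.
  rewrite -xye !inE eqxx orbT andbT; apply/eqP => yx.
  by move: e2; rewrite -xye yx cards2 eqxx.
rewrite mul1r mulr_ile1//; first by case/andP: (X01 J x).
by case/andP: (Y01 J y).
Qed.

Let in_KA x y : x \notin U -> y \notin U -> ([set x; y]%SET \in K :\: A) = (y != x).
Proof.
move=> xU yU; have dis : [disjoint [set x; y]%SET & U].
  rewrite disjoint_subset; apply/fintype.subsetP => z; rewrite !inE.
  by case/orP => /eqP->.
have xyA : [set x; y]%SET \notin A by rewrite inE dis andbF.
by rewrite finset.in_setD xyA inE cards2 eqSS eqb1 eq_sym.
Qed.

Let sum_al (J : graph) (w : edge -> R) :
  \sum_(e in K :\: A) al J e * w e =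
  \sum_x \sum_(y | y != x) X J x * Y J y * w [set x; y]%SET.
Proof.
rewrite /al; under eq_bigr do rewrite mulr_suml.
rewrite exchange_big; apply: eq_bigr => x _ /=.
under eq_bigr do rewrite mulr_suml.
rewrite exchange_big [RHS]big_mkcond; apply: eq_bigr => y _ /=.
have [xU|xU] := boolP (x \in U).
  by rewrite XU// big1 => [|e _]; rewrite ?mul0r ?mulr0 ?mul0r ?if_same.
have [yU|yU] := boolP (y \in U).
  by rewrite YU// big1 => [|e _]; rewrite ?mulr0 ?mul0r ?mulr0 ?mul0r ?if_same.
rewrite -in_KA//; case: ifPn => xyK.
  rewrite (bigD1 _ xyK)/= eqxx mul1r big1 ?addr0// => e /andP[_ /negbTE].
  by rewrite eq_sym => ->; rewrite !mul0r.
rewrite big1// => e eK; case: eqP => [xye|_]; last by rewrite !mul0r.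
by rewrite -xye (negbTE xyK) in eK.
Qed.

Lemma bilinear_tail (lam V : R) : 0 < lam -> lam <= 2 * V ->
  gnp_prob p (fun E => lam <= `|S E - mu E| /\ mu E <= V) <=
  2 * expR (- (lam ^+ 2 / (16 * V))).
Proof.
move=> lam0 lamV; have AK : A \subset K by apply/fintype.subsetP => e; rewrite inE => /andP[].
apply: le_trans (exposure_tail A al AK al_ge0 al_le2 lam V lam0 lamV).
apply: le_gnp_prob => E EK.
have -> : mu E = p * \sum_(e in K :\: A) al (E :&: A) e.
  congr (_ * _); transitivity (\sum_(e in K :\: A) al (E :&: A) e * 1).
    rewrite sum_al; apply: eq_bigr => x _; apply: eq_bigr => y _.
    by rewrite mulr1 -XA -YA.
  by apply: eq_bigr => e _; rewrite mulr1.
have -> // : S E = \sum_(e in K :\: A) al (E :&: A) e * (e \in E)%:R.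
rewrite sum_al; apply: eq_bigr => x _; rewrite [RHS]big_mkcond; apply: eq_bigr => y _ /=.
rewrite -XA -YA /adj; case: ifPn => //; rewrite negbK => /eqP->.
suff /negbTE-> : [set x; x]%SET \notin E by rewrite mulr0.
by apply/negP => /(fintype.subsetP EK); rewrite inE cards2 eqxx.
Qed.

End Bilinear.
End Exposure.

(** * From edge weights to a fractional triangle decomposition *)

Section FromWeights.
Variables (R : realType) (n : nat) (E : {set {set 'I_n}}).
Hypothesis EK : E \subset potential_edges n.
Notation a := (adj R n E).

Lemma adj_idem u v : a u v * a u v = a u v.
Proof. by rewrite /adj; case: (_ \in _); rewrite ?mulr1 ?mulr0. Qed.

Lemma adj_sym u v : a u v = a v u.
Proof. by rewrite /adj finset.setUC. Qed.

Lemma adj_irr u : a u u = 0.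
Proof.
rewrite /adj; suff /negbTE-> : [set u; u]%SET \notin E by [].
by apply/negP => /(fintype.subsetP EK); rewrite inE cards2 eqxx.
Qed.

Lemma triangle_setU1 u v w : [set u; v]%SET \in E -> w \notin [set u; v]%SET ->
  (w |: [set u; v] \in triangles E)%SET = ([set u; w]%SET \in E) && ([set v; w]%SET \in E).
Proof.
move=> uvE wuv; have uv : u != v.
  by apply: contraTneq uvE => ->; apply/negP => /(fintype.subsetP EK); rewrite inE cards2 eqxx.
rewrite inE cardsU1 wuv cards2 uv /=; apply/idP/andP.
  move=> /forallP H; move: wuv; rewrite !inE negb_or => /andP[wu wv]; split.
    have /implyP := H u; rewrite !inE eqxx orbT => /(_ isT)/forallP/(_ w).
    by rewrite !inE eqxx /= eq_sym wu.
  have /implyP := H v; rewrite !inE eqxx !orbT => /(_ isT)/forallP/(_ w).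
  by rewrite !inE eqxx /= eq_sym wv.
move=> [uw vw]; apply/forallP => x; apply/implyP; rewrite !inE => xT.
apply/forallP => y; apply/implyP; rewrite !inE => yT; apply/implyP => xy.
move: xy; case/or3P: xT => /eqP->; case/or3P: yT => /eqP->; rewrite ?eqxx// => _;
  by rewrite // finset.setUC.
Qed.

Lemma sum_triangles (F : {set 'I_n} -> R) u v : [set u; v]%SET \in E ->
  \sum_(T in triangles E | [set u; v]%SET \subset T) F T =
  \sum_w a u w * a v w * F (w |: [set u; v])%SET.
Proof.
move=> uvE; set e := [set u; v]%SET in uvE *.
have e2 : #|e| = 2 by have /(fintype.subsetP EK) := uvE; rewrite inE => /eqP.
(* A triangle T containing e has exactly one further vertex w. Summing over this single w and
   exchanging the sums indexes the triangles by w. *)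
transitivity (\sum_(T in triangles E | e \subset T) \sum_(w in T :\: e) F T).
  apply: eq_bigr => T /andP[]; rewrite inE => /andP[/eqP T3 _] eT.
  rewrite sumr_const; have -> : #|(T :\: e)%SET| = 1%N by rewrite cardsDS// T3 e2.
  by [].
rewrite (exchange_big_dep predT)//=; apply: eq_bigr => w _.
have [we|we] := boolP (w \in e).
  rewrite big1; last by move=> T /andP[_]; rewrite inE we.
  rewrite /e !inE in we; case/orP: we => /eqP->; by rewrite adj_irr ?mulr0 ?mul0r.
have Tw T : (T \in triangles E) && (e \subset T) && (w \in T :\: e)%SET =
    (T == (w |: e)%SET) && ((w |: e)%SET \in triangles E).
  apply/idP/idP => [/andP[/andP[Tt eT]]|/andP[/eqP-> ->]].
    rewrite inE => /andP[_ wT].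
    have TE : (w |: e)%SET = T.
      apply/eqP; rewrite eqEcard finset.subUset finset.sub1set wT eT /=.
      by move: Tt; rewrite inE cardsU1 we e2 => /andP[/eqP->].
    by rewrite TE eqxx.
  by rewrite finset.subsetUr finset.in_setD we finset.setU11.
rewrite (eq_bigl _ _ Tw) triangle_setU1// /adj -natrM mulnb.
case: (([set u; w]%SET \in E) && ([set v; w]%SET \in E)).
  by rewrite mul1r (eq_bigl (pred1 (w |: e)%SET)) ?big_pred1_eq// => T; rewrite andbT.
by rewrite mul0r big1// => T; rewrite andbF.
Qed.

Lemma decomposition_of_weights (Y : 'I_n -> 'I_n -> R) (d : R) : 0 < d ->
  (forall u v, 0 <= Y u v) -> (forall u v, Y u v = Y v u) -> (forall u, Y u u = 0) ->
  (forall u v, a u v = 1 -> \sum_w a u w * a v w * (Y u v + Y u w + Y v w) = d) ->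
  has_fractional_triangle_decomposition R E.
Proof.
move=> d0 Y0 Ysym Yirr YE.
(* The sum over ordered pairs of T counts each edge twice, hence 2 * d; the diagonal contributes
   nothing since Y u u = 0. *)
exists (fun T : {set 'I_n} => (\sum_(x in T) \sum_(y in T) Y x y) / (2 * d)); split.
  move=> T _; apply: divr_ge0; last by rewrite mulr_ge0 ?ltW.
  by do 2!(apply: sumr_ge0 => ? _).
move=> e eE; have := fintype.subsetP EK _ eE; rewrite inE => /cards2P[u [v [uv ee]]].
rewrite ee in eE *; rewrite sum_triangles//.
have auv : a u v = 1 by rewrite /adj eE.
apply: (mulIf (lt0r_neq0 d0)); rewrite mul1r -[RHS](YE u v auv) mulr_suml.
apply: eq_bigr => w _; rewrite -!mulrA.
have [we|we] := boolP (w \in [set u; v]%SET).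
  by rewrite !inE in we; case/orP: we => /eqP->; rewrite adj_irr ?mulr0 ?mul0r ?mulr0.
congr (_ * (_ * _)).
have sum3 (F : 'I_n -> R) : \sum_(x in (w |: [set u; v])%SET) F x = F w + (F u + F v).
  by rewrite finset.big_setU1//= finset.big_setU1 ?inE//= finset.big_set1.
by rewrite !sum3 !Yirr (Ysym w u) (Ysym w v) (Ysym v u); field; rewrite gt_eqF.
Qed.

End FromWeights.

(** * Union bound and complements in G(n,p) *)

Section GnpProb.
Variables (R : realType) (n : nat) (p : R).
Hypothesis p01 : 0 <= p <= 1.
Implicit Types B G : {set {set 'I_n}} -> Prop.

(** Markov's inequality for the number of indices i with [B i E]. *)
Lemma gnp_prob_exists (I : finType) (B : I -> {set {set 'I_n}} -> Prop) :
  gnp_prob p (fun E => exists i, B i E) <= \sum_i gnp_prob p (B i).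
Proof.
apply: le_trans (le_gnp_prob_wsum R n p p01 _
  (fun E : {set {set 'I_n}} => \sum_i (`[< B i E >])%:R) _ _) _.
- by move=> E; apply: sumr_ge0 => i _; rewrite ler0n.
- move=> E _ [i Bi]; rewrite (bigD1 i)//= asboolT// lerDl.
  by apply: sumr_ge0 => j _; rewrite ler0n.
under eq_bigr do rewrite mulr_sumr.
rewrite exchange_big; apply: ler_sum => i _; rewrite /gnp_prob [leRHS]big_mkcondr.
by apply: ler_sum => E _; case: ifP; rewrite ?mulr1 ?mulr0.
Qed.

Lemma gnp_prob_or3 B1 B2 B3 : gnp_prob p (fun E => [\/ B1 E, B2 E | B3 E]) <=
  gnp_prob p B1 + gnp_prob p B2 + gnp_prob p B3.
Proof.
apply: le_trans (_ : gnp_prob p (fun E => exists i : 'I_3, nth B1 [:: B1; B2; B3] i E) <= _).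
  apply: le_gnp_prob => // E _; case=> h.
  - by exists ord0.
  - by exists (lift ord0 ord0).
  - by exists ord_max.
apply: le_trans (gnp_prob_exists _ _) _.
by rewrite !big_ord_recl big_ord0 addr0 addrA.
Qed.

Lemma gnp_mass_sum : \sum_(E in powerset (potential_edges n)) gnp_mass p E = 1.
Proof.
by rewrite /gnp_mass sum_subsets_prod big1// => e _; rewrite addrC subrK.
Qed.

Lemma gnp_prob_le1 B : gnp_prob p B <= 1.
Proof.
rewrite -[leRHS]gnp_mass_sum /gnp_prob [leLHS]big_mkcondr; apply: ler_sum => E _.
by case: ifP => // _; exact: gnp_mass_ge0.
Qed.

Lemma gnp_prob_of_compl B G :
  (forall E : {set {set 'I_n}}, E \subset potential_edges n -> ~ B E -> G E) ->
  1 - gnp_prob p B <= gnp_prob p G.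
Proof.
move=> BG; rewrite lerBlDr -[leLHS]gnp_mass_sum /gnp_prob.
rewrite [X in _ <= X + _]big_mkcondr [X in _ <= _ + X]big_mkcondr -big_split /=.
apply: ler_sum => E; rewrite powersetE => EK; have m0 := gnp_mass_ge0 R n p p01 E.
case: asboolP => [_|nG]; case: asboolP => [_|nB]; rewrite ?addr0 ?add0r ?lerDl//.
by case: nG; exact: BG.
Qed.

End GnpProb.

(** * Concentration of degrees, codegrees and path counts *)

Section Deviations.
Variables (R : realType) (n : nat) (p del : R).
Hypothesis p01 : 0 <= p <= 1.
Hypothesis p_gt0 : 0 < p.
Hypothesis n_gt0 : 0 < n%:R :> R.
Hypothesis del_gt0 : 0 < del.
Hypothesis del_le1 : del <= 1.
Implicit Types (E J : {set {set 'I_n}}) (u v w x y : 'I_n).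
Let D : R := n%:R * p.
Let d : R := n%:R * p ^+ 2.
Let theta : R := n%:R ^+ 2 * p ^+ 5.
Notation a E := (adj R n E).

Definition deg_deviates u E : Prop :=
  del * D <= `|\sum_y a E u y - p * \sum_(y | y != u) 1|.

(* The bounds on m here and below make the tail estimates uniform; they hold automatically once
   the degrees, resp. the codegrees, do not deviate. *)
Definition codeg_deviates u v E : Prop :=
  let m := p * \sum_(y | y != v) a E u y in
  del * d <= `|\sum_y a E u y * a E v y - m| /\ m <= 2 * d.

(** Indicator of the common neighbours of u and w; w' is left out because its edges are among those
    exposed before the path count. *)
Let common u w w' E x : R := (x != w')%:R * (a E u x * a E w x).

Definition paths_deviate u w w' E : Prop :=
  let m := p * \sum_x \sum_(y | y != x) common u w w' E x * common u w' w E y in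
  del * theta <=
    `|\sum_x \sum_y common u w w' E x * common u w' w E y * a E x y - m| /\
  m <= 4 * theta.

Lemma adj_itv E u v : 0 <= a E u v <= 1.
Proof. by rewrite /adj; case: (_ \in _); rewrite lexx ler01. Qed.

Lemma adj_setI_exposed (U : {set 'I_n}) E u x : u \in U -> x != u ->
  a E u x = a (E :&: [set e in potential_edges n | ~~ [disjoint e & U]])%SET u x.
Proof.
move=> uU xu; rewrite /adj !inE cards2 [u == x]eq_sym xu /= (_ : ~~ _) ?andbT//.
by apply/pred0Pn; exists u; rewrite /= !inE eqxx.
Qed.

Let D_gt0 : 0 < D. Proof. exact: mulr_gt0. Qed.
Let d_gt0 : 0 < d. Proof. by rewrite mulr_gt0// exprn_gt0. Qed.
Let theta_gt0 : 0 < theta. Proof. by rewrite mulr_gt0// exprn_gt0. Qed.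

(** The bilinear form with X the indicator of u, Y = 1, nothing exposed and V = D. *)
Lemma deg_tail u : gnp_prob p (deg_deviates u) <= 2 * expR (- (del ^+ 2 * D / 16)).
Proof.
have lam0 : 0 < del * D by exact: mulr_gt0.
have lamV : del * D <= 2 * D by rewrite ler_pM2r//; have := del_le1; lra.
have X01 J x : 0 <= ((x == u)%:R : R) <= 1.
  by case: (x == u); rewrite ?lexx ?ler01.
have Y01 J x : 0 <= (1 : R) <= 1 by rewrite lexx ler01.
have XU J x : x \in finset.set0 -> (x == u)%:R = 0 :> R by rewrite inE.
have YU J x : x \in finset.set0 -> 1 = 0 :> R by rewrite inE.
have := bilinear_tail R n p p01 finset.set0 (fun _ x => (x == u)%:R) (fun _ _ => 1)
  X01 Y01 XU YU (fun _ _ => erefl) (fun _ _ => erefl) _ _ lam0 lamV.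
have -> : (del * D) ^+ 2 / (16 * D) = del ^+ 2 * D / 16 by field; rewrite gt_eqF.
apply: le_trans; apply: le_gnp_prob => // E _ dev.
have row (F : 'I_n -> 'I_n -> R) (P : 'I_n -> 'I_n -> bool) :
    \sum_x \sum_(y | P x y) (x == u)%:R * 1 * F x y = \sum_(y | P u y) F u y.
  rewrite (bigD1 u)//= [X in _ + X]big1 ?addr0 => [|x /negbTE->].
    by apply: eq_bigr => y _; rewrite eqxx !mul1r.
  by rewrite big1// => y _; rewrite !mul0r.
have := row (fun _ _ => 1) (fun x y => y != x).
under eq_bigr do under eq_bigr do rewrite mulr1.
move=> ->; rewrite (row (a E) (fun _ _ => true)); split=> //.
rewrite [leRHS]mulrC; apply: ler_wpM2l; first exact: ltW.
rewrite sumr_const ler_nat -[leqRHS]card_ord; exact: max_card.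
Qed.

(** Expose the edges at u. The codegree is then the form with X the indicator of v and Y that of
    N(u), and V = 2 d. *)
Lemma codeg_tail u v : u != v ->
  gnp_prob p (codeg_deviates u v) <= 2 * expR (- (del ^+ 2 * d / 32)).
Proof.
move=> uv; have lam0 : 0 < del * d by exact: mulr_gt0.
have lamV : del * d <= 2 * (2 * d) by have := ler_wpM2r (ltW d_gt0) del_le1; have := d_gt0; lra.
(* The factor makes Y vanish at u for every set E of vertex sets, even one that contains the
   singleton of u. *)
pose Y E y : R := (y != u)%:R * a E u y.
have X01 J x : 0 <= ((x == v)%:R : R) <= 1.
  by case: (x == v); rewrite ?lexx ?ler01.
have Y01 J x : 0 <= Y J x <= 1.
  by rewrite /Y; case: (x != u); rewrite ?mul1r ?mul0r ?adj_itv ?lexx ?ler01.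
have XU J x : x \in [set u]%SET -> (x == v)%:R = 0 :> R.
  by rewrite inE => /eqP->; rewrite (negbTE uv).
have YU J x : x \in [set u]%SET -> Y J x = 0 by rewrite inE /Y => ->; rewrite mul0r.
have YA E x : Y E x = Y (E :&: [set e in potential_edges n | ~~ [disjoint e & [set u]]])%SET x.
  rewrite /Y; case: (boolP (x != u)) => xu; last by rewrite !mul0r.
  by rewrite (adj_setI_exposed [set u]%SET) ?inE.
have := bilinear_tail R n p p01 [set u]%SET (fun _ x => (x == v)%:R) Y
  X01 Y01 XU YU (fun _ _ => erefl) YA _ _ lam0 lamV.
have -> : (del * d) ^+ 2 / (16 * (2 * d)) = del ^+ 2 * d / 32 by field; rewrite gt_eqF.
apply: le_trans; apply: le_gnp_prob => // E EK dev.
have YE y : Y E y = a E u y.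
  rewrite /Y; case: eqP => [->|_]; last by rewrite mul1r.
  by rewrite adj_irr ?mulr0.
have row (F : 'I_n -> 'I_n -> R) (P : 'I_n -> 'I_n -> bool) :
    \sum_x \sum_(y | P x y) (x == v)%:R * F x y = \sum_(y | P v y) F v y.
  rewrite (bigD1 v)//= [X in _ + X]big1 ?addr0 => [|x /negbTE->].
    by apply: eq_bigr => y _; rewrite eqxx mul1r.
  by rewrite big1// => y _; rewrite mul0r.
have -> : \sum_x \sum_(y | y != x) (x == v)%:R * Y E y = \sum_(y | y != v) a E u y.
  by rewrite (row (fun _ y => Y E y) (fun x y => y != x)); apply: eq_bigr => y _; rewrite YE.
have -> // : \sum_x \sum_y (x == v)%:R * Y E y * a E x y = \sum_y a E u y * a E v y.
under eq_bigr do under eq_bigr do rewrite -mulrA.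
by rewrite (row (fun x y => Y E y * a E x y) (fun _ _ => true)); apply: eq_bigr => y _; rewrite YE.
Qed.

(** Expose the edges at u, w and w'. X and Y are then known indicators of common neighbourhoods,
    only the middle edge xy is random, and V = 4 theta. *)
Lemma paths_tail u w w' : u != w -> u != w' ->
  gnp_prob p (paths_deviate u w w') <= 2 * expR (- (del ^+ 2 * theta / 64)).
Proof.
move=> uw uw'; have lam0 : 0 < del * theta by exact: mulr_gt0.
have lamV : del * theta <= 2 * (4 * theta).
  by have := ler_wpM2r (ltW theta_gt0) del_le1; have := theta_gt0; lra.
pose U : {set 'I_n} := [set u; w; w']%SET.
pose X v E x : R := (x \notin U)%:R * (a E u x * a E v x).
have X01 v J x : 0 <= X v J x <= 1.
  rewrite /X; case: (x \notin U); rewrite ?mul1r ?mul0r ?lexx ?ler01//.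
  have /andP[h1 h2] := adj_itv J u x; have /andP[h3 h4] := adj_itv J v x.
  by rewrite mulr_ge0 ?mulr_ile1.
have XU v J x : x \in U -> X v J x = 0 by rewrite /X => ->; rewrite mul0r.
have XA v E x : v \in U ->
    X v E x = X v (E :&: [set e in potential_edges n | ~~ [disjoint e & U]])%SET x.
  move=> vU; rewrite /X; case: (boolP (x \notin U)) => xU; last by rewrite !mul0r.
  rewrite -!adj_setI_exposed//; first by apply: contraNneq xU => ->.
    by rewrite !inE eqxx.
  by apply: contraNneq xU => ->; rewrite !inE eqxx.
have wU : w \in U by rewrite !inE eqxx !orbT.
have wU' : w' \in U by rewrite !inE eqxx !orbT.
have := bilinear_tail R n p p01 U (X w) (X w') (X01 w) (X01 w') (XU w) (XU w')
  (fun E x => XA w E x wU) (fun E x => XA w' E x wU') _ _ lam0 lamV.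
have -> : (del * theta) ^+ 2 / (16 * (4 * theta)) = del ^+ 2 * theta / 64.
  by field; rewrite gt_eqF.
apply: le_trans; apply: le_gnp_prob => // E EK; rewrite /paths_deviate.
have XE v v' x : (x \in U) = [|| x == u, x == v | x == v'] -> X v E x = common u v v' E x.
  rewrite /X /common => ->; rewrite !negb_or.
  case: eqP => [->|_]; first by rewrite adj_irr// !(mulr0, mul0r).
  case: eqP => [->|_]; first by rewrite (adj_irr _ _ _ EK v) !(mulr0, mul0r).
  by [].
have eX x : X w E x = common u w w' E x by apply: XE; rewrite !inE orbA.
have eY x : X w' E x = common u w' w E x by apply: XE; rewrite !inE -orbA [X in _ || X]orbC.
have prodE (P : 'I_n -> 'I_n -> bool) (F : 'I_n -> 'I_n -> R) :
    \sum_x \sum_(y | P x y) X w E x * X w' E y * F x y =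
    \sum_x \sum_(y | P x y) common u w w' E x * common u w' w E y * F x y.
  by apply: eq_bigr => x _; apply: eq_bigr => y _; rewrite eX eY.
have := prodE (fun x y => y != x) (fun _ _ => 1).
under eq_bigr do under eq_bigr do rewrite mulr1.
under [in RHS]eq_bigr do under eq_bigr do rewrite mulr1.
by move=> ->; rewrite (prodE (fun _ _ => true) (a E)).
Qed.

(** * Without deviations the graph is pseudorandom *)

Section NoDeviation.
Variable E : {set {set 'I_n}}.
Hypothesis EK : E \subset potential_edges n.
Hypothesis del_small : 36 * del <= 1.
Hypothesis d_large : 1 <= del * d.
Hypothesis deg_ok : forall u, ~ deg_deviates u E.
Hypothesis codeg_ok : forall u v, u != v -> ~ codeg_deviates u v E.
Hypothesis paths_ok : forall u w w', u != w -> u != w' -> ~ paths_deviate u w w' E.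

Let p_le1 : p <= 1. Proof. by case/andP: p01. Qed.
Let pD : p * D = d. Proof. by rewrite /D /d; ring. Qed.
Let pd2 : p * d ^+ 2 = theta. Proof. by rewrite /theta /d; ring. Qed.
Let p_small : p <= del * d. Proof. exact: le_trans d_large. Qed.

Lemma regular_deg u : `|\sum_w a E u w - D| <= 2 * del * D.
Proof.
have := deg_ok u; rewrite /deg_deviates => /negP; rewrite -ltNge.
have -> : p * \sum_(y < n | y != u) 1 = D - p.
  have : \sum_(y < n) 1 = n%:R :> R by rewrite sumr_const card_ord.
  rewrite (bigD1 u)//= => /esym/(congr1 (fun t : R => p * t)).
  by rewrite [LHS]mulrC -/D => ->; ring.
have p_le : p <= del * D.
  apply: le_trans p_small _; rewrite -pD mulrCA; apply: ler_piMl => //.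
  exact: ltW (mulr_gt0 del_gt0 D_gt0).
have := p_gt0; rewrite ltr_norml ler_norml => ? /andP[? ?].
by apply/andP; split; lra.
Qed.

Let deg_itv u : (1 - 2 * del) * D <= \sum_w a E u w <= (1 + 2 * del) * D.
Proof.
by have := regular_deg u; rewrite ler_norml => /andP[? ?]; apply/andP; split; lra.
Qed.

(** By the degree bound and p <= del d, the conditional mean is within 3 del d of d; in particular
    it is at most 2 d, so the excluded event gives one more del d. *)
Lemma regular_codeg u v : u != v ->
  `|\sum_w a E u w * a E v w - d| <= 4 * del * d.
Proof.
move=> uv; have := codeg_ok u v uv; rewrite /codeg_deviates.
have -> : \sum_(y | y != v) a E u y = \sum_y a E u y - a E u v.
  by rewrite [X in _ = X - _](bigD1 v)//= addrAC subrr add0r.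
set c := \sum_w _; set s := \sum_y _.
have /andP[a0 a1] := adj_itv E u v; have /andP[s1 s2] := deg_itv u; rewrite -/s in s1 s2.
have ps1 := ler_wpM2l (ltW p_gt0) s1; have ps2 := ler_wpM2l (ltW p_gt0) s2.
have pa1 := ler_wpM2l (ltW p_gt0) a1; have pa0 := mulr_ge0 (ltW p_gt0) a0.
rewrite mulrCA pD in ps1; rewrite mulrCA pD in ps2; rewrite mulr1 in pa1.
have dd := ler_wpM2r (ltW d_gt0) del_small; have := p_small => ps.
have m_le : p * (s - a E u v) <= 2 * d by rewrite mulrBr; have := d_gt0; lra.
move=> nd; have {nd} : ~~ (del * d <= `|c - p * (s - a E u v)|).
  by apply/negP => h; apply: nd.
rewrite -ltNge ltr_norml ler_norml mulrBr => /andP[h1 h2].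
have := mulr_gt0 del_gt0 d_gt0 => dd0; apply/andP; split; lra.
Qed.

Let common_itv u w w' x : 0 <= common u w w' E x <= 1.
Proof.
have /andP[h1 h2] := adj_itv E u x; have /andP[h3 h4] := adj_itv E w x.
rewrite /common; case: (x != w'); rewrite ?mul0r ?lexx ?ler01// mul1r.
by rewrite mulr_ge0 ?mulr_ile1.
Qed.

(** Omitting w' changes the codegree by at most 1 <= del d, which turns 4 del into 5 del. *)
Let sum_common u w w' : u != w ->
  (1 - 5 * del) * d <= \sum_x common u w w' E x <= (1 + 5 * del) * d.
Proof.
move=> uw; have := regular_codeg u w uw; rewrite ler_norml => /andP[h1 h2].
have cE : \sum_x a E u x * a E w x = \sum_x common u w w' E x + a E u w' * a E w w'.
  rewrite (bigD1 w')//= [in RHS](bigD1 w')//= /common eqxx mul0r add0r addrC; congr (_ + _).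
  by apply: eq_bigr => x ->; rewrite mul1r.
rewrite cE in h1 h2.
have /andP[b1 b2] := adj_itv E u w'; have /andP[b3 b4] := adj_itv E w w'.
have b5 := mulr_ge0 b1 b3; have b6 : a E u w' * a E w w' <= 1 by exact: mulr_ile1.
by have dl := d_large; apply/andP; split; lra.
Qed.

(** The conditional mean is p (sX sY - sXY), where sX and sY lie within 5 del d of d, the diagonal
    sXY is at most 2 d <= 2 del d^2, and p d^2 = theta. These errors and the deviation del theta
    stay below 18 del theta. *)
Lemma regular_paths u w w' : a E u w = 1 -> a E u w' = 1 ->
  `|\sum_(x | x != w') \sum_(y | y != w)
      a E u x * a E w x * (a E u y * a E w' y) * a E x y - theta| <= 18 * del * theta.
Proof.
move=> auw auw'.
have neq v : a E u v = 1 -> u != v.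
  by move=> h; apply: contra_eq_neq h => ->; rewrite (adj_irr _ _ _ EK) eq_sym oner_eq0.
have uw := neq w auw; have uw' := neq w' auw'.
have := paths_ok u w w' uw uw'; rewrite /paths_deviate.
have -> : \sum_(x | x != w') \sum_(y | y != w)
      a E u x * a E w x * (a E u y * a E w' y) * a E x y =
    \sum_x \sum_y common u w w' E x * common u w' w E y * a E x y.
  rewrite big_mkcond; apply: eq_bigr => x _; rewrite /common.
  case: (x != w') => /=; last by rewrite big1// => y _; rewrite !mul0r.
  rewrite big_mkcond; apply: eq_bigr => y _.
  by case: (y != w) => /=; rewrite ?mul1r// !(mul0r, mulr0).
set S := \sum_x \sum_y _.
pose sX := \sum_x common u w w' E x; pose sY := \sum_y common u w' w E y.
pose sXY := \sum_x common u w w' E x * common u w' w E x.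
have mE : \sum_x \sum_(y | y != x) common u w w' E x * common u w' w E y = sX * sY - sXY.
  rewrite mulr_suml -sumrB; apply: eq_bigr => x _; rewrite -mulr_sumr -mulrBr; congr (_ * _).
  by rewrite /sY [in RHS](bigD1 x)//= addrAC subrr add0r.
rewrite mE.
have /andP[x1 x2] : (1 - 5 * del) * d <= sX <= (1 + 5 * del) * d := sum_common u w w' uw.
have /andP[y1 y2] : (1 - 5 * del) * d <= sY <= (1 + 5 * del) * d := sum_common u w' w uw'.
have c0 : 0 <= 1 - 5 * del by have := del_small; lra.
have cd0 : 0 <= (1 - 5 * del) * d by rewrite mulr_ge0// ltW.
have xy1 : ((1 - 5 * del) * d) * ((1 - 5 * del) * d) <= sX * sY by exact: ler_pM.
have xy2 : sX * sY <= ((1 + 5 * del) * d) * ((1 + 5 * del) * d).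
  by apply: ler_pM => //; [exact: le_trans x1|exact: le_trans y1].
have z0 : 0 <= sXY.
  apply: sumr_ge0 => x _; apply: mulr_ge0; first by case/andP: (common_itv u w w' x).
  by case/andP: (common_itv u w' w x).
have z1 : sXY <= sX.
  apply: ler_sum => x _; have /andP[? ?] := common_itv u w w' x.
  by have /andP[? ?] := common_itv u w' w x; rewrite ler_piMr.
have z2 : sXY <= 2 * del * d ^+ 2.
  have := ler_wpM2r (ltW d_gt0) d_large; have := ler_wpM2r (ltW d_gt0) del_small.
  by have := d_gt0; rewrite expr2; lra.
have pz0 := mulr_ge0 (ltW p_gt0) z0.
have pz2 := ler_wpM2l (ltW p_gt0) z2.
have pxy1 := ler_wpM2l (ltW p_gt0) xy1; have pxy2 := ler_wpM2l (ltW p_gt0) xy2.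
have e1 : p * ((1 - 5 * del) * d * ((1 - 5 * del) * d)) = (1 - 5 * del) ^+ 2 * theta.
  by rewrite -pd2; ring.
have e2 : p * ((1 + 5 * del) * d * ((1 + 5 * del) * d)) = (1 + 5 * del) ^+ 2 * theta.
  by rewrite -pd2; ring.
have e3 : p * (2 * del * d ^+ 2) = 2 * del * theta by rewrite -pd2; ring.
rewrite e1 in pxy1; rewrite e2 in pxy2; rewrite e3 in pz2.
have dt0 := mulr_gt0 del_gt0 theta_gt0; have t0 := theta_gt0.
have dt := ler_wpM2r (ltW theta_gt0) del_small.
have ddt := ler_wpM2r (ltW dt0) del_small.
have m_le : p * (sX * sY - sXY) <= 4 * theta by rewrite mulrBr; lra.
move=> nd; have {nd} : ~~ (del * theta <= `|S - p * (sX * sY - sXY)|).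
  by apply/negP => h; apply: nd.
rewrite -ltNge ltr_norml ler_norml mulrBr => /andP[h1 h2].
by apply/andP; split; nra.
Qed.

End NoDeviation.

(** A union bound with one index set, the n^3 triples, for all three kinds of event. Each has
    probability at most 2 T, since the denominators 16, 32 and 64 are at most 64. *)
Lemma deviation_tail (m : R) : m <= D -> m <= d -> m <= theta ->
  gnp_prob p (fun E => exists t : 'I_n * 'I_n * 'I_n, let: (u, w, w') := t in
    [\/ deg_deviates u E, u != w /\ codeg_deviates u w E |
        (u != w) && (u != w') /\ paths_deviate u w w' E]) <=
  6 * n%:R ^+ 3 * expR (- (del ^+ 2 * m / 64)).
Proof.
move=> mD md mt; set T := expR _.
have T0 : 0 <= T by exact: expR_ge0.
have expo (y c : R) : m <= y -> 0 < y -> 0 < c -> c <= 64 ->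
    expR (- (del ^+ 2 * y / c)) <= T.
  move=> my y0 c0 c64; rewrite ler_expR lerN2 -[leLHS]mulrA -[leRHS]mulrA.
  apply: ler_wpM2l; first exact: sqr_ge0.
  rewrite ler_pdivlMr// mulrAC ler_pdivrMr//.
  by have := ler_wpM2l (ltW y0) c64; have := ler_wpM2r (ltW c0) my; lra.
have guard (b : bool) (B : {set {set 'I_n}} -> Prop) (y : R) : 0 <= y ->
    (b -> gnp_prob p B <= y) -> gnp_prob p (fun E => b /\ B E) <= y.
  move=> y0; case: b => [/(_ isT) h|_].
    by apply: le_trans h; apply: le_gnp_prob => // E _ [].
  apply: le_trans y0; rewrite /gnp_prob big1// => E.
  by case: asboolP => [[]//|_]; rewrite andbF.
apply: le_trans (gnp_prob_exists _ _ _ p01 _ _) _.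
apply: le_trans (_ : \sum_(t : 'I_n * 'I_n * 'I_n) 6 * T <= _).
  apply: ler_sum => -[[u w] w'] _.
  apply: le_trans (gnp_prob_or3 _ _ _ p01 _ _ _) _.
  have h1 : gnp_prob p (deg_deviates u) <= 2 * T.
    by apply: le_trans (deg_tail u) _; rewrite ler_pM2l// expo//; lra.
  have h2 : gnp_prob p (fun E => u != w /\ codeg_deviates u w E) <= 2 * T.
    apply: guard => [|uw]; first by rewrite mulr_ge0.
    by apply: le_trans (codeg_tail u w uw) _; rewrite ler_pM2l// expo//; lra.
  have h3 : gnp_prob p (fun E => (u != w) && (u != w') /\ paths_deviate u w w' E) <= 2 * T.
    apply: guard => [|/andP[uw uw']]; first by rewrite mulr_ge0.
    by apply: le_trans (paths_tail u w w' uw uw') _; rewrite ler_pM2l// expo//; lra.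
  lra.
rewrite sumr_const !card_prod !card_ord -[leLHS]mulr_natl !natrM.
by rewrite le_eqVlt; apply/orP; left; apply/eqP; ring.
Qed.

End Deviations.

(** * Numerical choice of the parameters *)

Section ErrorBounds.
Variables (R : realFieldType) (x Di di : R).
Hypothesis x_gt0 : 0 < x.
Hypothesis x_le : 100 * x <= 1.
Hypothesis Di_itv : 0 <= Di <= x ^+ 4.
Hypothesis di_le : di <= x ^+ 4.
(** Here x stands for n^(-1/66), [Di] and [di] for 1 / D and 1 / d. The deviation is del = x^4, the
    18 is that of [regular_paths], and eta is taken to be x. *)
Let dl := 18 * x ^+ 4.
Let zeta2 := 5 * (16 * dl ^+ 2 + 32 * (8 * dl ^+ 2 + 2 * x ^+ 2) +
  24 * (dl ^+ 2 + (3 * dl + 3 * Di))).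

Lemma del_bounds : 36 * x ^+ 4 <= 1 /\ dl <= 1 / 2.
Proof.
have x_le1 : x <= 1 by have hx := x_gt0; have := x_le; lra.
have x3 : x ^+ 3 <= 1 by apply: exprn_ile1 => //; exact: ltW.
have x0 := ltW x_gt0.
have : 100 * x ^+ 4 <= 1.
  rewrite (_ : 100 * _ = (100 * x) * x ^+ 3); last by ring.
  by apply: mulr_ile1; [exact: mulr_ge0 (ler0n _ _) x0|exact: exprn_ge0|exact: x_le|exact: x3].
by rewrite /dl; split; lra.
Qed.

Lemma eta_bound : 2 * dl + 8 * di <= x ^+ 3.
Proof.
have : 100 * x ^+ 4 <= x ^+ 3.
  rewrite (_ : 100 * _ = (100 * x) * x ^+ 3); last by ring.
  by apply: ler_piMl; [exact: exprn_ge0 (ltW x_gt0)|exact: x_le].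
by rewrite /dl; have x4 := exprn_ge0 4 (ltW x_gt0); have := di_le; lra.
Qed.

Lemma zeta2_bounds : 0 <= zeta2 <= 400 * x ^+ 2 /\ zeta2 <= 1 / 4.
Proof.
have x2 : 100 * x ^+ 2 <= x by rewrite expr2 mulrA; apply: ler_piMl => //; exact: ltW.
have x4 : 100 * (100 * x ^+ 4) <= x ^+ 2.
  have -> : 100 * (100 * x ^+ 4) = (100 * x) * (100 * x) * x ^+ 2 by ring.
  apply: ler_piMl; first exact: sqr_ge0.
  have x100 : 0 <= 100 * x by apply: mulr_ge0 (ler0n _ _) (ltW x_gt0).
  exact: mulr_ile1.
have [_ dl_le] := del_bounds.
have dl_ge0 : 0 <= dl by rewrite mulr_ge0// exprn_ge0// ltW.
have dl2 : dl ^+ 2 <= dl by rewrite expr2; apply: ler_piMl => //; lra.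
have dl2_ge0 := sqr_ge0 dl; have x2_ge0 := sqr_ge0 x.
have /andP[Di0 Di1] := Di_itv.
have dlE : dl = 18 * x ^+ 4 by []; have xl := x_le.
have zeta_le : zeta2 <= 400 * x ^+ 2 by rewrite /zeta2; lra.
split; last by lra.
by apply/andP; split => //; rewrite /zeta2; lra.
Qed.

(** With n = s^66, the factor n^2 = s^132 meets zeta2^67 <= 400^67 x^134: 67 is the first number of
    iterations that leaves a positive power of x. *)
Lemma tail_bound (s C : R) : s * x = 1 -> 400 ^+ 67 <= C ^+ 2 ->
  4 * (s ^+ 66) ^+ 2 * zeta2 ^+ 67 <= (2 * C * x) ^+ 2.
Proof.
move=> sx C_ge; have [/andP[z0 z1] _] := zeta2_bounds.
have x0 := ltW x_gt0.
apply: le_trans (_ : 4 * (s ^+ 66) ^+ 2 * (C ^+ 2 * (x ^+ 2) ^+ 67) <= _).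
  apply: ler_wpM2l; first by rewrite mulr_ge0 ?sqr_ge0.
  apply: le_trans (_ : (400 * x ^+ 2) ^+ 67 <= _).
    move: zeta2 (400 * x ^+ 2) z0 z1 => z y z0 zy.
    by apply: lerXn2r; rewrite ?nnegrE//; exact: le_trans zy.
  by rewrite exprMn; apply: ler_wpM2r => //; apply: exprn_ge0; exact: sqr_ge0.
have e : (s ^+ 66) ^+ 2 * (x ^+ 2) ^+ 66 = 1.
  by rewrite exprAC -exprMn -exprMn sx !expr1n.
rewrite (exprS (x ^+ 2) 66).
rewrite (_ : _ * _ = (2 * C * x) ^+ 2 * ((s ^+ 66) ^+ 2 * (x ^+ 2) ^+ 66)).
  by rewrite e mulr1.
by move: ((s ^+ 66) ^+ 2) ((x ^+ 2) ^+ 66) => y z; ring.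
Qed.

(** As dl = 18 x^4 <= 18 x, a factor x comes out of both terms, and a small x beats the constant
    25^67. *)
Lemma sup_bound (C1 C2 : R) : 25 ^+ 67 <= C1 ->
  12 * (67%:R * 18 * C1 + 2 * C2) * x <= 1 ->
  12 * (67%:R * 25 ^+ 67 * dl + 2 * C2 * x) <= 1.
Proof.
move=> C1_ge; apply: le_trans; rewrite -[leRHS]mulrA ler_pM2l ?ltr0n//.
rewrite [leRHS]mulrDl lerD2r /dl.
have x0 := ltW x_gt0; have x_le1 : x <= 1 by have := x_gt0; have := x_le; lra.
rewrite (_ : _ * (18 * _) = 67%:R * 18 * (25 ^+ 67 * x ^+ 4)); last first.
  by move: (25 ^+ 67) => y; ring.
rewrite -[leRHS]mulrA; apply: ler_wpM2l; first by rewrite mulr_ge0 ?ler0n.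
apply: ler_pM; [exact: exprn_ge0|exact: exprn_ge0|exact: C1_ge|].
by rewrite exprS; apply: ler_piMr => //; exact: exprn_ile1.
Qed.

End ErrorBounds.

(* In terms of s = n^(1/66): n p^2 >= s^18, n^2 p^5 >= s^12, and all quantities deviate by
   relative errors O(s^-4), so that zeta2 = O(s^-2) and n^2 * zeta2^67 = O(s^-2). *)
Lemma decomposition_prob_ge (R : realType) (n : nat) (p s C1 C2 : R) :
  0 <= p <= 1 -> n%:R = s ^+ 66 -> s ^- 24 <= p -> 100 <= s ->
  25 ^+ 67 <= C1 -> 0 <= C2 -> 400 ^+ 67 <= C2 ^+ 2 ->
  12 * (67%:R * 18 * C1 + 2 * C2) <= s ->
  1 - 6 * s ^+ 198 * expR (- (s ^+ 4 / 64)) <=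
  gnp_prob p (fun E : {set {set 'I_n}} => has_fractional_triangle_decomposition R E).
Proof.
move=> p01 nE ps s_large C1_ge C2_ge0 C2_ge sC.
have /andP[p_ge0 p_le1] := p01.
have s_gt0 : 0 < s by lra.
have s_ge1 : 1 <= s by lra.
have p_gt0 : 0 < p by apply: lt_le_trans ps; rewrite invr_gt0 exprn_gt0.
pose x := s^-1; have x_gt0 : 0 < x by rewrite invr_gt0.
have sx : s * x = 1 by rewrite /x divff// gt_eqF.
have x_le1 : x <= 1 by rewrite invf_le1.
have x_le : 100 * x <= 1 by rewrite -[leRHS]sx ler_pM2r.
have xC : 12 * (67%:R * 18 * C1 + 2 * C2) * x <= 1 by rewrite -[leRHS]sx ler_pM2r.
(* The threshold is s^-24 = n^(-24/66) = n^(-4/11). In terms of q and s, the quantities D, d and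
   theta become s^42 q, s^18 q^2 and s^12 q^5, so s^12 bounds all three from below. *)
have [q q_ge1 pE] : exists2 q, 1 <= q & p = q * x ^+ 24.
  exists (p * s ^+ 24); last by rewrite -mulrA -exprMn sx expr1n mulr1.
  by rewrite -ler_pdivrMr ?exprn_gt0// mul1r.
have red k l : (s ^+ (k + l)) * x ^+ l = s ^+ k.
  by rewrite exprD -mulrA -exprMn sx expr1n mulr1.
have DE : n%:R * p = s ^+ 42 * q by rewrite nE pE mulrCA (red 42 24)%N mulrC.
have dE : n%:R * p ^+ 2 = s ^+ 18 * q ^+ 2.
  by rewrite nE pE [(q * _) ^+ 2]exprMn -[(x ^+ 24) ^+ 2]exprM mulrCA (red 18 48)%N mulrC.
have tE : n%:R ^+ 2 * p ^+ 5 = s ^+ 12 * q ^+ 5.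
  rewrite nE pE [(q * _) ^+ 5]exprMn -[(x ^+ 24) ^+ 5]exprM -[(s ^+ 66) ^+ 2]exprM.
  by rewrite mulrCA (red 12 120)%N mulrC.
have big k j : (12 <= k)%N -> s ^+ 12 <= s ^+ k * q ^+ j.
  move=> k12; apply: le_trans (_ : s ^+ k <= _); first exact: ler_weXn2l.
  by rewrite ler_peMr ?exprn_ge0 ?exprn_ege1// ltW.
have mD : s ^+ 12 <= n%:R * p by rewrite DE -[q]expr1 big.
have md : s ^+ 12 <= n%:R * p ^+ 2 by rewrite dE big.
have mt : s ^+ 12 <= n%:R ^+ 2 * p ^+ 5 by rewrite tE big.
have n_gt0 : 0 < n%:R :> R by rewrite nE exprn_gt0.
pose del := x ^+ 4.
have del_gt0 : 0 < del by rewrite exprn_gt0.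
have x12 : x ^+ 12 <= del.
  rewrite /del (_ : 12 = 4 + 8)%N// exprD; apply: ler_piMr; first exact: exprn_ge0 (ltW _).
  by apply: exprn_ile1 => //; exact: ltW.
have inv_le y : s ^+ 12 <= y -> 0 <= y^-1 <= del.
  move=> sy; have y0 : 0 < y by apply: lt_le_trans sy; rewrite exprn_gt0.
  rewrite invr_ge0 ltW//=; apply: le_trans x12.
  by rewrite /x exprVn lef_pV2 ?posrE ?exprn_gt0.
have d_gt0 : 0 < n%:R * p ^+ 2 by rewrite mulr_gt0// exprn_gt0.
have D_gt0 : 0 < n%:R * p by exact: mulr_gt0.
have Di := inv_le _ mD; have /andP[di_ge0 di_le] := inv_le _ md.
have d_large : 1 <= del * (n%:R * p ^+ 2) by rewrite -ler_pdivrMr// mul1r.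
have [del36 dl_le] := del_bounds R x x_gt0 x_le; rewrite -/del in del36 dl_le.
have eta_ge := eta_bound R x _ x_gt0 x_le di_le; rewrite -/del in eta_ge.
have [_ zeta4] := zeta2_bounds R x _ x_gt0 x_le Di; rewrite -/del in zeta4.
have cK := tail_bound R x _ x_gt0 x_le Di s C2 sx C2_ge; rewrite -/del -nE in cK.
have sup_le := sup_bound R x x_gt0 x_le C1 C2 C1_ge xC; rewrite -/del in sup_le.
clear sC C1_ge C2_ge xC.
have del_le1 : del <= 1 by apply: le_trans del36; rewrite ler_peMl ?ler1n// ltW.
have tail := deviation_tail R n p del p01 p_gt0 n_gt0 del_gt0 del_le1 _ mD md mt.
(* With del = s^-4, the exponent del^2 s^12 of the union bound is s^4, against a number n^3 = s^198
   of triples. *)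
have expE : del ^+ 2 * s ^+ 12 / 64 = s ^+ 4 / 64.
  by congr (_ / _); rewrite /del -exprM mulrC (red 4 8)%N.
rewrite expE nE -exprM in tail.
apply: le_trans (gnp_prob_of_compl _ _ _ p01 _ _ _); first by rewrite lerD2l lerN2; exact: tail.
move=> E EK no_dev.
have deg_ok u : ~ deg_deviates R n p del u E.
  by move=> h; apply: no_dev; exists (u, u, u); constructor 1.
have codeg_ok u v : u != v -> ~ codeg_deviates R n p del u v E.
  by move=> uv h; apply: no_dev; exists (u, v, v); constructor 2.
have paths_ok u w w' : u != w -> u != w' -> ~ paths_deviate R n p del u w w' E.
  by move=> uw uw' h; apply: no_dev; exists (u, w, w'); constructor 3; rewrite uw uw'.
have degP u : `|\sum_w adj R n E u w - n%:R * p| <= 18 * del * (n%:R * p).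
  apply: le_trans (regular_deg R n p del p01 p_gt0 n_gt0 del_gt0 E d_large deg_ok u) _.
  by rewrite !ler_pM2r// ler_nat.
have codegP u v : u != v -> `|\sum_w adj R n E u w * adj R n E v w - n%:R * p ^+ 2| <=
    18 * del * (n%:R * p ^+ 2).
  move=> uv; apply: le_trans (regular_codeg R n p del p01 p_gt0 n_gt0 del_gt0 E
    del36 d_large deg_ok codeg_ok u v uv) _.
  by rewrite !ler_pM2r// ler_nat.
have pathsP := regular_paths R n p del p01 p_gt0 n_gt0 del_gt0 E EK del36 d_large
  deg_ok codeg_ok paths_ok.
have dl_ge0 : 0 <= 18 * del by rewrite mulr_ge0// ltW.
have c_ge0 : 0 <= 2 * C2 * x by rewrite mulr_ge0// ?mulr_ge0// ltW.
have [Y [Y0 Ysym Yirr YE]] := triangle_weights R n (adj R n E) p (18 * del)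
  (adj_idem R n E) (adj_sym R n E) (adj_irr R n E EK) p_gt0 p_le1 n_gt0 dl_ge0 dl_le
  degP codegP pathsP x (ltW x_gt0) eta_ge 67 (2 * C2 * x) zeta4 c_ge0 cK sup_le.
exact: decomposition_of_weights R n E EK Y _ d_gt0 Y0 Ysym Yirr YE.
Qed.

(** * Passage to the limit *)

Lemma expR_dominates (R : realType) (k : nat) (y : R) : 0 <= y ->
  y ^+ k.+1 * expR (- y) <= k.+1`!%:R.
Proof.
move=> y0; have := expR_ge1Dxn k y0; have f0 : 0 < k.+1`!%:R :> R by rewrite ltr0n fact_gt0.
have e1 : expR y * expR (- y) = 1 by rewrite -expRD subrr expR0.
move=> h; have : y ^+ k.+1 / k.+1`!%:R <= expR y by apply: le_trans h; rewrite lerDr.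
rewrite ler_pdivrMr// => /(ler_wpM2r (expR_ge0 (- y))).
by rewrite mulrAC e1 mul1r.
Qed.

Lemma tail_decay (R : realType) : exists C : R, forall s : R, 1 <= s ->
  6 * s ^+ 198 * expR (- (s ^+ 4 / 64)) <= C / s.
Proof.
(* The fiftieth power of y = s^4 / 64 is used because (s^4)^50 = s^200 exceeds s^198 * s. *)
exists (6 * (64 ^+ 50 * (49.+1)`!%:R)) => s s_ge1.
have s_gt0 : 0 < s by exact: lt_le_trans s_ge1.
have y_ge0 : 0 <= s ^+ 4 / 64 by rewrite divr_ge0 ?exprn_ge0 ?ler0n// ltW.
have := expR_dominates R 49 (s ^+ 4 / 64) y_ge0.
have e_ge0 := expR_ge0 (- (s ^+ 4 / 64)).
move: (expR _) ((49.+1)`!%:R) e_ge0 => e f e_ge0.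
rewrite expr_div_n -exprM.
have c_gt0 : 0 < 64 ^+ 50 :> R by rewrite exprn_gt0// ltr0n.
move: (64 ^+ 50) c_gt0 => c c_gt0; rewrite mulrAC ler_pdivrMr// => h.
rewrite ler_pdivlMr// (_ : 6 * _ * e * s = 6 * (s ^+ 199 * e)); last first.
  by rewrite (exprSr s 198); move: (s ^+ 198) => t; ring.
rewrite ler_pM2l ?ltr0n// [c * f]mulrC; apply: le_trans h.
by apply: ler_wpM2r => //; exact: ler_weXn2l.
Qed.

Local Open Scope classical_set_scope.
Local Open Scope ring_scope.

Theorem theorem1p1 (R : realType) (eps : R) (p : nat -> R)
    (heps : 0 < eps)
    (hp01 : forall n : nat, 0 <= p n <= 1)
    (hp : forall n : nat, (0 < n)%N -> n%:R `^ (- (4%:R / 11%:R) + eps) <= p n) :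
  (fun n : nat => gnp_prob (p n)
     (fun E : {set {set 'I_n}} => has_fractional_triangle_decomposition R E))
    @ \oo --> (1 : R).
Proof.
(* The left side is -24 / 66 = -4 / 11, which makes s^-24 a lower bound for p. *)
have exponent_le : 66%:R^-1 * - 24%:R <= - (4%:R / 11%:R) + eps by lra.
have [C1 C1_ge] : exists C : R, 25 ^+ 67 <= C by exists (25 ^+ 67).
have [C2 C2_ge0 C2_ge] : exists2 C : R, 0 <= C & 400 ^+ 67 <= C ^+ 2.
  exists (400 ^+ 67); first by exact: exprn_ge0 (ler0n _ _).
  have : 1 <= 400 ^+ 67 :> R by rewrite exprn_ege1// ler1n.
  by move: (400 ^+ 67) => C C_ge1; rewrite expr2 ler_peMl// (le_trans ler01).
have [C3 decay] := tail_decay R.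
apply/cvgrPdist_le => e e_gt0.
(* For s >= M the three terms give s >= 100, the smallness needed for the sup norm, and C3 / s <=
   e. *)
pose M := `|100| + `|12 * (67%:R * 18 * C1 + 2 * C2)| + `|C3 / e|.
have M_ge0 : 0 <= M by rewrite !addr_ge0.
have [M1 M2 M3] : [/\ 100 <= M, 12 * (67%:R * 18 * C1 + 2 * C2) <= M & C3 / e <= M].
  rewrite /M; move: (12 * _) (C3 / e) (100) => t1 t2 t3.
  have := ler_norm t1; have := ler_norm t2; have := ler_norm t3.
  have := normr_ge0 t1; have := normr_ge0 t2; have := normr_ge0 t3.
  by move=> *; split; lra.
(* Beyond this index n >= M^66, that is s >= M; the successor also ensures n > 0, so that the lower
   bound on p applies. *)
exists (Num.truncn (M ^+ 66)).+1 => // n /= Nn.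
have n_ge : M ^+ 66 <= n%:R.
  by apply: ltW; apply: lt_le_trans (truncnS_gt _) _; rewrite ler_nat.
have n_gt0 : (0 < n)%N by exact: leq_trans Nn.
pose s : R := n%:R `^ (66%:R^-1).
have nE : n%:R = s ^+ 66.
  by rewrite -powR_mulrn ?powR_ge0// -powRrM mulVf ?pnatr_eq0// powRr1.
have s_ge0 : 0 <= s by exact: powR_ge0.
have Ms : M <= s by rewrite -(ler_pXn2r (_ : 0 < 66)%N) ?nnegrE// -nE.
have ps : s ^- 24 <= p n.
  apply: le_trans (hp n n_gt0).
  by rewrite -powR_invn// -powRrM; apply: ler_powR; rewrite // ler1n.
have s100 := le_trans M1 Ms.
have s_ge1 : 1 <= s by apply: le_trans s100; rewrite ler1n.
have lb := decomposition_prob_ge R n (p n) s C1 C2 (hp01 n) nE ps s100 C1_ge C2_ge0 C2_ge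
  (le_trans M2 Ms).
have ub := gnp_prob_le1 R n (p n) (hp01 n)
  (fun E : {set {set 'I_n}} => has_fractional_triangle_decomposition R E).
rewrite ger0_norm ?subr_ge0// lerBlDr -lerBlDl; apply: le_trans lb.
rewrite lerD2l lerN2; apply: le_trans (decay s s_ge1) _.
have s_gt0 : 0 < s by exact: lt_le_trans s_ge1.
by rewrite ler_pdivrMr// mulrC -ler_pdivrMr// (le_trans M3).
Qed.
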